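(* Let $d\ge 1$, let $\Lambda\subset\mathbb{R}^d$ be a $d$-dimensional lattice and let $C\subset\mathbb{R}^d$ be a convex body. (1) If $C$ is lattice reduced with respect to $\Lambda$, then $C$ is a polytope with at most $2^{d+1}-2$ vertices. (2) If $C$ is lattice complete with respect to $\Lambda$, then $C$ is a polytope with at most $2^{d+1}-2$ facets. In both statements the bound $2^{d+1}-2$ cannot be improved: for every $d$ there exist a $d$-dimensional lattice and a lattice reduced polytope with exactly $2^{d+1}-2$ vertices, and a $d$-dimensional lattice and a lattice complete polytope with exactly $2^{d+1}-2$ facets.
   Context: A convex body is a compact convex set in $\mathbb{R}^d$ with non-empty interior. A lattice $\Lambda\subset\mathbb{R}^d$ is a discrete subgroup of $\mathbb{R}^d$; it is $d$-dimensional if it spans $\mathbb{R}^d$. The dual lattice is $\Lambda^\star=\{y\in\mathbb{R}^d: x\cdot y\in\mathbb{Z}\ \forall x\in\Lambda\}$. The lattice width of a convex body $C$ is $\mathrm{wdt}_\Lambda(C)=\min_{y\in\Lambda^\star\setminus\{0\}}\max_{a,b\in C} y\cdot(a-b)$. A segment $I=[a,b]$ is a lattice segment if $b-a$ is parallel to some nonzero vector of $\Lambda$; then $v_I$ denotes the unique generator of $\Lambda\cap\mathrm{span}\{b-a\}$ that is a positive multiple of $b-a$, and the lattice length of $I$ is $|b-a|/|v_I|$ (Euclidean norms). The lattice diameter $\mathrm{diam}_\Lambda(C)$ is the maximum lattice length of a lattice segment contained in $C$. $C$ is lattice reduced w.r.t. $\Lambda$ if no convex body $C'\subsetneq C$ has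 $\mathrm{wdt}_\Lambda(C')=\mathrm{wdt}_\Lambda(C)$; $C$ is lattice complete w.r.t. $\Lambda$ if no convex body $C'\supsetneq C$ has $\mathrm{diam}_\Lambda(C')=\mathrm{diam}_\Lambda(C)$. *)

(* Defs.v *)
From mathcomp Require Import all_boot all_order all_algebra.
From mathcomp Require Import all_classical all_reals all_analysis.
Import Order.TTheory GRing.Theory Num.Theory.
Import numFieldTopology.Exports numFieldNormedType.Exports.
Set Implicit Arguments. Unset Strict Implicit. Unset Printing Implicit Defensive.
Local Open Scope ring_scope.
Local Open Scope classical_set_scope.

Section Defs.
Variables (R : realType) (d : nat).
Local Notation vec := 'rV[R]_d.

Definition dotp (x y : vec) : R := \sum_(i < d) x 0 i * y 0 i.
Definition enorm (x : vec) : R := Num.sqrt (dotp x x).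

Definition is_subgroup (L : set vec) : Prop :=
  L 0 /\ (forall x y, L x -> L y -> L (x - y)).
Definition is_discrete (L : set vec) : Prop :=
  forall x, L x -> exists2 r : R, 0 < r &
    forall y, L y -> y <> x -> r <= enorm (y - x).
Definition spans (L : set vec) : Prop :=
  forall x : vec, exists n (s : 'I_n -> vec) (c : 'I_n -> R),
    (forall i, L (s i)) /\ x = \sum_(i < n) c i *: s i.
Definition is_lattice (L : set vec) : Prop :=
  is_subgroup L /\ is_discrete L /\ spans L.

Definition dual_lattice (L : set vec) : set vec :=
  [set y | forall x, L x -> dotp x y \is a Num.int].

Definition convex_set (C : set vec) : Prop :=
  forall x y (t : R), C x -> C y -> 0 <= t <= 1 -> C ((1 - t) *: x + t *: y).
Definition convex_body (C : set vec) : Prop :=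
  compact C /\ convex_set C /\ (C°) !=set0.

Definition width_dir (C : set vec) (y : vec) : R :=
  sup [set w | exists a b, C a /\ C b /\ w = dotp y (a - b)].
Definition lattice_width (L : set vec) (C : set vec) : R :=
  inf [set w | exists y, dual_lattice L y /\ y <> 0 /\ w = width_dir C y].

(* lattice segments and lattice length.
   [a,b] (a <> b) is a lattice segment if b - a is parallel to a nonzero
   lattice vector; v_I is the lattice vector s *: (b - a), s > 0, with s
   minimal (the positive generator of L \cap span{b-a});
   the lattice length is |b - a| / |v_I|. *)
Definition segment_in (C : set vec) (a b : vec) : Prop :=
  forall t : R, 0 <= t <= 1 -> C ((1 - t) *: a + t *: b).
Definition is_lattice_segment (L : set vec) (a b : vec) : Prop :=
  a <> b /\ exists v, L v /\ v <> 0 /\ exists t : R, b - a = t *: v.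
Definition is_vI (L : set vec) (a b v : vec) : Prop :=
  L v /\ (exists2 s : R, 0 < s & v = s *: (b - a)) /\
  (forall u : vec, L u -> (exists t : R, u = t *: (b - a)) ->
     exists k : int, u = k%:~R *: v).
Definition lattice_length (L : set vec) (a b : vec) (l : R) : Prop :=
  exists v, is_vI L a b v /\ l = enorm (b - a) / enorm v.
Definition lattice_diam (L : set vec) (C : set vec) : R :=
  sup [set l | exists a b, segment_in C a b /\ is_lattice_segment L a b /\
                           lattice_length L a b l].

Definition lattice_reduced (L : set vec) (C : set vec) : Prop :=
  ~ exists C' : set vec, convex_body C' /\ C' `<` C /\
      lattice_width L C' = lattice_width L C.
Definition lattice_complete (L : set vec) (C : set vec) : Prop :=
  ~ exists C' : set vec, convex_body C' /\ C `<` C' /\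
      lattice_diam L C' = lattice_diam L C.

Definition conv_hull n (p : 'I_n -> vec) : set vec :=
  [set x | exists lam : 'I_n -> R, (forall i, 0 <= lam i) /\
     \sum_(i < n) lam i = 1 /\ x = \sum_(i < n) lam i *: p i].
Definition is_polytope (P : set vec) : Prop :=
  exists n (p : 'I_n -> vec), P = conv_hull p.

Definition is_vertex (P : set vec) (x : vec) : Prop :=
  P x /\ forall y z (t : R), P y -> P z -> 0 < t < 1 ->
    x = (1 - t) *: y + t *: z -> y = z.

Definition aff_indep k (p : 'I_k -> vec) : Prop :=
  forall c : 'I_k -> R, \sum_(i < k) c i = 0 ->
    \sum_(i < k) c i *: p i = 0 -> forall i, c i = 0.

Definition is_exposed_face (P F : set vec) : Prop :=
  exists (u : vec) (c : R), u <> 0 /\ (forall x, P x -> dotp u x <= c) /\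
    F = [set x | P x /\ dotp u x = c].
(* facet = face of dimension d - 1 (contains d affinely independent points) *)
Definition is_facet (P F : set vec) : Prop :=
  is_exposed_face P F /\
  exists p : 'I_d -> vec, (forall i, F (p i)) /\ aff_indep p.

Definition num_vertices_eq (P : set vec) (n : nat) : Prop :=
  exists f : 'I_n -> vec, injective f /\
    forall x, is_vertex P x <-> exists i, x = f i.
Definition num_facets_eq (P : set vec) (n : nat) : Prop :=
  exists f : 'I_n -> set vec, injective f /\
    forall F, is_facet P F <-> exists i, F = f i.
End Defs.

(* Main.v *)
(** Upper bound in (1): replacing C by (1 - t) C + t K, where K is the hull of points maximizing the
    width directions over C, does not decrease the width when t is small, because all other dual
    vectors have width bounded away from the minimum.  So a reduced C satisfies C = (1 - t) C + t K,
    and iterating gives C = K.  As the maximizers were arbitrary, each vertex of C is the unique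
    maximizer of a width direction y.  If y = y' mod 2 for a second width direction y' other than y
    and -y, then (y + y')/2 and (y - y')/2 are width directions too, which forces y' to be both
    maximal and minimal at that vertex.  So each of the 2^d - 1 nonzero classes modulo 2 accounts for
    at most two vertices.  Part (2) is dual: K becomes an intersection of slabs containing C, one for
    each longest lattice direction v, with boundary normals supporting C - C at (diam C) v.

    Sharpness: with avg_T the average over T and x_0 = 0, the functionals
    x -> avg_T x - avg_(T^c) x, for T a proper nonempty subset of {0, ..., d}, are at least 1 for some T
    on every nonzero integer vector and are bounded by 1 on the vectors 1_S, with equality only for
    S = T.  The polytope cut out by these functionals and their convex hull are extremal for Z^d. *)
From mathcomp Require Import all_boot all_order all_algebra.
From mathcomp Require Import all_classical all_reals all_analysis.
From mathcomp Require Import ring lra zify.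
Require Import Defs.
Import Order.TTheory GRing.Theory Num.Def Num.Theory.
Import numFieldTopology.Exports numFieldNormedType.Exports.
Set Implicit Arguments. Unset Strict Implicit. Unset Printing Implicit Defensive.
Local Open Scope ring_scope.
Local Open Scope classical_set_scope.

(** * Vectors, compactness and convex hulls *)

(** The hull [K] of maximizers cannot replace [C] outright: in a direction that does not attain the
    minimum, its width may collapse. A small share [t] of [K] costs such a direction no more than
    its margin over the minimum. In part (2) the same device mixes in a larger body, and the margin
    absorbs the growth of segments that are not longest. Part (2) passes through [C - C], where a
    longest segment becomes a boundary point; the normal of a facet, unique up to scaling, takes the
    place of the unique maximizer. A lattice basis would give the 2^d classes modulo 2 at once.
    Lattices are given here as discrete spanning subgroups, so the bound comes from a growth
    estimate for subgroups whose nonzero elements have norms bounded away from 0; for the dual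
    lattice that gap follows from the spanning of [L]. *)

Lemma sum_continuous (R : realType) (T : topologicalType)
    (V : pseudoMetricNormedZmodType R) (I : Type) (r : seq I) (F : I -> T -> V) :
  (forall i, continuous (F i)) -> continuous (fun x => \sum_(i <- r) F i x).
Proof.
move=> cF; elim: r => [|i r IHr].
  have -> : (fun x => \sum_(i <- [::]) F i x) = (fun=> 0).
    by apply/funext => x; rewrite big_nil.
  exact: cst_continuous.
have -> : (fun x => \sum_(j <- i :: r) F j x) =
    (fun x => F i x + \sum_(j <- r) F j x).
  by apply/funext => x; rewrite big_cons.
by move=> x; apply: cvgD; [exact: cF|exact: IHr].
Qed.

Section Vectors.
Variables (R : realType) (d : nat).
Local Notation vec := 'rV[R]_d.
Implicit Types (x y z u v : vec) (C K : set vec).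

Lemma dotpC x y : dotp x y = dotp y x.
Proof. by apply: eq_bigr => i _; rewrite mulrC. Qed.

Lemma dotpDr u x y : dotp u (x + y) = dotp u x + dotp u y.
Proof. by rewrite /dotp -big_split; apply: eq_bigr => i _; rewrite mxE mulrDr. Qed.

Lemma dotpZr u (a : R) x : dotp u (a *: x) = a * dotp u x.
Proof. by rewrite /dotp mulr_sumr; apply: eq_bigr => i _; rewrite mxE mulrCA. Qed.

Lemma dotpNr u x : dotp u (- x) = - dotp u x.
Proof. by rewrite -scaleN1r dotpZr mulN1r. Qed.

Lemma dotpBr u x y : dotp u (x - y) = dotp u x - dotp u y.
Proof. by rewrite dotpDr dotpNr. Qed.

Lemma dotp0r u : dotp u 0 = 0.
Proof. by rewrite -(scale0r 0) dotpZr mul0r. Qed.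

Lemma dotp_sumr u (I : Type) (r : seq I) (P : pred I) (F : I -> vec) :
  dotp u (\sum_(i <- r | P i) F i) = \sum_(i <- r | P i) dotp u (F i).
Proof. exact: (big_morph _ (dotpDr u) (dotp0r u)). Qed.

Lemma dotpDl u x y : dotp (x + y) u = dotp x u + dotp y u.
Proof. by rewrite !(dotpC _ u) dotpDr. Qed.

Lemma dotpZl u (a : R) x : dotp (a *: x) u = a * dotp x u.
Proof. by rewrite !(dotpC _ u) dotpZr. Qed.

Lemma dotpNl u x : dotp (- x) u = - dotp x u.
Proof. by rewrite !(dotpC _ u) dotpNr. Qed.

Lemma dotpBl u x y : dotp (x - y) u = dotp x u - dotp y u.
Proof. by rewrite dotpDl dotpNl. Qed.

Lemma dotp0l u : dotp 0 u = 0.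
Proof. by rewrite dotpC dotp0r. Qed.

Definition dotpE := (dotpDr, dotpDl, dotpNr, dotpNl, dotpZr, dotpZl, dotp0r, dotp0l).

Lemma dotp_delta u (i : 'I_d) : dotp u (delta_mx 0 i) = u 0 i.
Proof.
rewrite /dotp (bigD1 i)//= mxE !eqxx mulr1 big1 ?addr0// => j ji.
by rewrite mxE (negbTE ji) andbF mulr0.
Qed.

Lemma dotp_ge0 x : 0 <= dotp x x.
Proof. by apply: sumr_ge0 => i _; rewrite -expr2 sqr_ge0. Qed.

Lemma dotp_eq0 x : dotp x x = 0 -> x = 0.
Proof.
move=> /eqP; rewrite psumr_eq0 => [/allP x0|i _]; last by rewrite -expr2 sqr_ge0.
apply/rowP => i; rewrite mxE; have := x0 i; rewrite mem_index_enum => /(_ isT)/=.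
by rewrite mulf_eq0 orbb => /eqP.
Qed.

Lemma dotp_gt0 x : x <> 0 -> 0 < dotp x x.
Proof. by move=> x0; rewrite lt_def dotp_ge0 andbT; apply/eqP => /dotp_eq0. Qed.

Lemma dotp_continuous u : continuous (dotp u).
Proof.
apply: sum_continuous => i x.
apply: (@continuous_comp _ _ _ (fun M : vec => M 0 i) (fun t => u 0 i * t)).
  exact: coord_continuous.
exact: mulrl_continuous.
Qed.

Lemma compact_argmax u C : compact C -> C !=set0 ->
  exists2 c, C c & forall x, C x -> dotp u x <= dotp u c.
Proof.
move=> cC C0; have [|c cC' cmax] := @EVT_max_rV _ _ (dotp u) _ C0 cC.
  exact/continuous_subspaceT/dotp_continuous.
by exists c; [rewrite inE in cC'|move=> x Cx; apply: cmax; rewrite inE].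
Qed.

Lemma coord_le_norm x i : `|x 0 i| <= `|x|.
Proof.
by rewrite [leRHS]/normr /= mx_normrE; apply/bigmax_geP; right; exists (0, i).
Qed.

Lemma norm_le_coord x (M : R) : 0 <= M -> (forall i, `|x 0 i| <= M) -> `|x| <= M.
Proof.
move=> M0 xM; rewrite /normr /= mx_normrE; apply/bigmax_leP; split=> // -[j i] _.
by rewrite /= ord1.
Qed.

Lemma norm_lt_coord x (M : R) : 0 < M -> (forall i, `|x 0 i| < M) -> `|x| < M.
Proof.
move=> M0 xM; rewrite /normr /= mx_normrE; apply/bigmax_ltP; split=> // -[j i] _.
by rewrite /= ord1.
Qed.

Lemma dotp_le_norm u x : `|dotp u x| <= (\sum_(i < d) `|u 0 i|) * `|x|.
Proof.
rewrite mulr_suml; apply: le_trans (ler_norm_sum _ _ _) _.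
by apply: ler_sum => i _; rewrite normrM ler_wpM2l// coord_le_norm.
Qed.

Lemma enorm_ge0 x : 0 <= enorm x. Proof. exact: sqrtr_ge0. Qed.

Lemma enormZ (t : R) x : enorm (t *: x) = `|t| * enorm x.
Proof.
by rewrite /enorm !dotpE mulrA -expr2 sqrtrM ?sqr_ge0// sqrtr_sqr.
Qed.

Lemma enorm_gt0 x : x <> 0 -> 0 < enorm x.
Proof. by move=> /dotp_gt0 x0; rewrite sqrtr_gt0. Qed.

(** The crude factor suffices because d <= (d + 1)^2, and it is invertible for every [d]. *)
Lemma enorm_le_norm x : enorm x <= d.+1%:R * `|x|.
Proof.
rewrite -[leRHS]ger0_norm ?mulr_ge0// -sqrtr_sqr ler_sqrt ?sqr_ge0//.
apply: (@le_trans _ _ (\sum_(i < d) `|x| ^+ 2)).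
  apply: ler_sum => i _; rewrite -expr2 -(real_normK (num_real (x 0 i))).
  by rewrite lerXn2r ?nnegrE// coord_le_norm.
rewrite sumr_const card_ord exprMn -[leLHS]mulr_natl ler_wpM2r ?sqr_ge0//.
by rewrite -natrX ler_nat; nia.
Qed.

Lemma interior_ball C x : C° x ->
  exists2 r : R, 0 < r & forall y, `|y| <= r -> C (x + y).
Proof.
move=> /nbhs_ballP[e /= e0 eC]; exists (e / 2) => [|y ye]; first by rewrite divr_gt0.
apply: eC; rewrite -ball_normE /= opprD addrA subrr sub0r normrN.
by apply: le_lt_trans ye _; rewrite ltr_pdivrMr// ltr_pMr// ltr1n.
Qed.

Lemma ball_interior C x (r : R) : 0 < r -> (forall y, `|y| <= r -> C (x + y)) ->
  C° x.
Proof.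
move=> r0 rC; apply/nbhs_ballP; exists r => //= y; rewrite -ball_normE /= => xy.
by rewrite -[y](subrK x) addrC; apply: rC; rewrite -normrN opprB ltW.
Qed.

Lemma compact_norm_bound C : compact C ->
  exists2 M : R, 0 < M & forall x, C x -> `|x| <= M.
Proof.
move=> /compact_bounded/ex_strict_bound_gt0[M M0 CM]; exists M => // x Cx.
exact/ltW/CM.
Qed.

Lemma compact_is_closed C : compact C -> closed C.
Proof. by apply: compact_closed; exact: norm_hausdorff. Qed.

Lemma closed_limit C x : closed C ->
  (forall e : R, 0 < e -> exists2 y, C y & `|y - x| <= e) -> C x.
Proof.
move=> cC xC; rewrite ((closure_id C).1 cC) => B /nbhs_ballP[e /= e0 eB].
have [|y Cy yx] := xC (e / 2); first by rewrite divr_gt0.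
exists y; split => //; apply: eB; rewrite -ball_normE /= -normrN opprB.
by apply: le_lt_trans yx _; rewrite ltr_pdivrMr// ltr_pMr// ltr1n.
Qed.

Lemma halfspace_closed u (c : R) : closed [set x | dotp u x <= c].
Proof.
have -> : [set x | dotp u x <= c] = dotp u @^-1` [set t | t <= c] by [].
apply: preimage_closed; last exact: closed_le.
by move=> x _; exact: dotp_continuous.
Qed.

Lemma mulr_pow_small (r M e : R) : 0 <= r -> r < 1 -> 0 < e ->
  exists n, r ^+ n * M <= e.
Proof.
move=> r0 r1 e0.
have rn : (fun n => r ^+ n * M) @ \oo --> (0 * M : R).
  by apply: cvgM; [apply: cvg_expr; rewrite ger0_norm|exact: cvg_cst].
rewrite mul0r in rn; have /cvgrPdist_le/(_ e e0)[n _ nP] := rn.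
by exists n; have := nP n (leqnn n); rewrite /= sub0r normrN; exact/le_trans/ler_norm.
Qed.

Lemma convex_sum C n (lam : 'I_n -> R) (p : 'I_n -> vec) : convex_set C ->
  (forall i, 0 <= lam i) -> \sum_(i < n) lam i = 1 ->
  (forall i, C (p i)) -> C (\sum_(i < n) lam i *: p i).
Proof.
move=> cC; elim: n => [|n IHn] in lam p *.
  by rewrite big_ord0 => _ /eqP; rewrite eq_sym oner_eq0.
move=> l0; rewrite !big_ord_recl => l1 Cp; set s := (\sum_(i < n) _) in l1.
have s0 : 0 <= s by apply: sumr_ge0.
have [s00|sn0] := eqVneq s 0.
  move/eqP: s00; rewrite psumr_eq0 // => /allP s00.
  rewrite big1 ?addr0 => [|i _]; last first.
    by have /eqP -> := s00 i (mem_index_enum i); rewrite scale0r.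
  have -> : lam ord0 = 1 by rewrite -l1 /s big1 ?addr0// => i _; apply/eqP/s00/mem_index_enum.
  by rewrite scale1r.
have -> : \sum_(i < n) lam (lift ord0 i) *: p (lift ord0 i) =
    s *: \sum_(i < n) (lam (lift ord0 i) / s) *: p (lift ord0 i).
  by rewrite scaler_sumr; apply: eq_bigr => i _; rewrite scalerA mulrCA divff ?mulr1.
have -> : lam ord0 = 1 - s by rewrite -l1 addrK.
apply: cC => //; last by rewrite s0 -l1 lerDr l0.
apply: IHn => // [i|]; first by rewrite divr_ge0.
by rewrite -mulr_suml -/s divff.
Qed.

Lemma conv_hull_convex n (p : 'I_n -> vec) : convex_set (conv_hull p).
Proof.
move=> x y t [a [a0 [a1 ->]]] [b [b0 [b1 ->]]] /andP[t0 t1].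
exists (fun i => (1 - t) * a i + t * b i); split => [i|].
  by rewrite addr_ge0 ?mulr_ge0 ?subr_ge0.
split; first by rewrite big_split /= -!mulr_sumr a1 b1 !mulr1 subrK.
rewrite !scaler_sumr -big_split /=; apply: eq_bigr => i _.
by rewrite [in RHS]scalerDl !scalerA.
Qed.

Lemma conv_hull_mem n (p : 'I_n -> vec) i : conv_hull p (p i).
Proof.
exists (fun j => (j == i)%:R); split; first by move=> j; rewrite ler0n.
split; first by rewrite (bigD1 i)//= eqxx big1 ?addr0// => j /negbTE ->.
by rewrite (bigD1 i)//= eqxx scale1r big1 ?addr0// => j /negbTE ->; rewrite scale0r.
Qed.

Lemma conv_hull_sub n (p : 'I_n -> vec) C : convex_set C ->
  (forall i, C (p i)) -> conv_hull p `<=` C.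
Proof. by move=> cC Cp x [a [a0 [a1 ->]]]; exact: convex_sum. Qed.

End Vectors.

Section Simplex.
Variables (R : realType) (d : nat).
Local Notation vec := 'rV[R]_d.

Lemma halfspaces_closed (I : Type) (D : set I) (u : I -> vec) (c : I -> R) :
  closed [set x | forall i, D i -> dotp (u i) x <= c i].
Proof.
have -> : [set x | forall i, D i -> dotp (u i) x <= c i] =
    \bigcap_(i in D) [set x | dotp (u i) x <= c i] by [].
by apply: closed_bigI => i _; exact: halfspace_closed.
Qed.

Lemma simplex_compact :
  compact [set a : vec | (forall i, 0 <= a 0 i) /\ \sum_(i < d) a 0 i = 1].
Proof.
set S := (X in compact X).
have dot1 (a : vec) : dotp (const_mx 1) a = \sum_(i < d) a 0 i.
  by apply: eq_bigr => i _; rewrite mxE mul1r.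
apply: bounded_closed_compact.
  exists 1; split; first exact: num_real.
  move=> M M1 a [a0 a1]; apply: le_trans (ltW M1).
  apply: norm_le_coord => // i; rewrite ger0_norm//.
  by rewrite -a1 (bigD1 i)//= lerDl sumr_ge0.
have -> : S = [set a | forall i, setT i -> dotp (- delta_mx 0 i) a <= 0] `&`
    ([set a | dotp (const_mx 1) a <= 1] `&` [set a | dotp (- const_mx 1) a <= -1]).
  apply/seteqP; split => a /=.
    move=> [a0 a1]; rewrite dotpNl dot1 a1 !lexx; split=> // i _.
    by rewrite dotpNl dotpC dotp_delta oppr_le0.
  move=> [a0]; rewrite dotpNl dot1 lerN2 => -[a1 a2]; split.
    by move=> i; have := a0 i I; rewrite dotpNl dotpC dotp_delta oppr_le0.
  by apply/eqP; rewrite eq_le a1.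
by apply: closedI; [exact: halfspaces_closed|apply: closedI; exact: halfspace_closed].
Qed.

End Simplex.

Lemma conv_hull_compact (R : realType) (d n : nat) (p : 'I_n -> 'rV[R]_d) :
  compact (conv_hull p).
Proof.
pose f (a : 'rV[R]_n) : 'rV[R]_d := \sum_(i < n) a 0 i *: p i.
have -> : conv_hull p =
    f @` [set a : 'rV[R]_n | (forall i, 0 <= a 0 i) /\ \sum_(i < n) a 0 i = 1].
  apply/seteqP; split => [x [a [a0 [a1 ->]]]|_ [a [a0 a1] <-]].
    exists (\row_i a i).
      by split=> [i|]; [rewrite mxE|rewrite -a1; apply: eq_bigr => i _; rewrite mxE].
    by rewrite /f; apply: eq_bigr => i _; rewrite mxE.
  by exists (a 0).
apply: continuous_compact; last exact: simplex_compact.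
apply/continuous_subspaceT/sum_continuous => i a.
have ca := @coord_continuous R 1 n 0 i a.
have cs : continuous (fun t : R => t *: p i) by exact: scalel_continuous.
exact: (continuous_comp ca (cs _)).
Qed.

(** * Minkowski combinations and lattices modulo 2 *)

Section Minkowski.
Variables (R : realType) (d : nat).
Local Notation vec := 'rV[R]_d.
Implicit Types (x y z u v : vec) (C K : set vec).

Definition mink (t : R) C K : set vec :=
  [set x | exists2 c, C c & exists2 k, K k & x = (1 - t) *: c + t *: k].

Lemma mink_convex t C K : convex_set C -> convex_set K -> convex_set (mink t C K).
Proof.
move=> cC cK _ _ s [c Cc [k Kk ->]] [c' Cc' [k' Kk' ->]] s01.
exists ((1 - s) *: c + s *: c'); first exact: cC.
exists ((1 - s) *: k + s *: k'); first exact: cK.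
by apply/rowP => i; rewrite !mxE; ring.
Qed.

Lemma mink_compact t C K : compact C -> compact K -> compact (mink t C K).
Proof.
move=> cC cK.
have -> : mink t C K = (fun p : vec * vec => (1 - t) *: p.1 + t *: p.2) @` (C `*` K).
  apply/seteqP; split => [_ [c Cc [k Kk ->]]|_ [[c k] [Cc Kk] <-]].
    by exists (c, k).
  by exists c => //; exists k.
apply: continuous_compact; last exact: compact_setX.
apply: continuous_subspaceT => p; apply: cvgD; apply: cvgZl_tmp.
  exact: cvg_fst.
exact: cvg_snd.
Qed.

(** A ball of radius r in [C] survives as one of radius (1 - t) r, so [K] may be flat. *)
Lemma mink_body t C K : convex_body C -> compact K -> convex_set K -> K !=set0 ->
  t < 1 -> convex_body (mink t C K).
Proof.
move=> [cC [xC [q Cq]]] cK xK [k Kk] t1; split; first exact: mink_compact.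
split; first exact: mink_convex.
have [r r0 rC] := interior_ball Cq.
exists ((1 - t) *: q + t *: k); apply: (@ball_interior _ _ _ _ ((1 - t) * r)).
  by rewrite mulr_gt0// subr_gt0.
have t0 : 1 - t != 0 by rewrite subr_eq0 eq_sym lt_eqF.
move=> y yr; exists (q + (1 - t)^-1 *: y); last first.
  by exists k => //; apply/rowP => i; rewrite !mxE; field.
apply: rC; rewrite normrZ gtr0_norm ?invr_gt0 ?subr_gt0//.
by rewrite mulrC ler_pdivrMr ?subr_gt0// mulrC.
Qed.

(** Each use of the inclusion shrinks the distance to [K] by the factor 1 - t: if [k1] in [K]
    approximates [c], then (1 - t) k1 + t k approximates (1 - t) c + t k. As [C] is bounded, the
    distance tends to 0. *)
Lemma sub_mink_sub t C K : compact C -> C !=set0 -> 0 < t -> t <= 1 ->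
  closed K -> convex_set K -> C `<=` mink t C K -> C `<=` K.
Proof.
move=> cC [q Cq] t0 t1 clK cK CCK x Cx.
have [M M0 CM] := compact_norm_bound cC.
have [c0 Cc0 [k0 Kk0 _]] := CCK q Cq.
have step n y : C y -> exists2 k, K k & `|k - y| <= (1 - t) ^+ n * (M + `|k0|).
  elim: n => [|n IHn] in y *.
    move=> Cy; exists k0 => //; rewrite expr0 mul1r.
    by rewrite (le_trans (ler_normB _ _))// addrC lerD2r CM.
  move=> /CCK[c Cc [k Kk ->]]; have [k1 Kk1 kc] := IHn c Cc.
  exists ((1 - t) *: k1 + t *: k).
    by apply: cK => //; rewrite t1 ltW.
  have -> : (1 - t) *: k1 + t *: k - ((1 - t) *: c + t *: k) = (1 - t) *: (k1 - c).
    by apply/rowP => i; rewrite !mxE; ring.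
  by rewrite normrZ ger0_norm ?subr_ge0// exprS -mulrA ler_wpM2l ?subr_ge0.
apply: closed_limit => // e e0.
have [||n nP] := @mulr_pow_small _ (1 - t) (M + `|k0|) e _ _ e0.
  by rewrite subr_ge0.
  by rewrite ltrBlDr ltrDl.
by have [k Kk kx] := step n x Cx; exists k => //; apply: le_trans kx nP.
Qed.

(** For x in [K] the contraction c -> (1 - t) c + t x maps [C] into itself, so its orbit stays in
    the closed set [C] and converges to x. *)
Lemma mink_sub_sub t C K : compact C -> C !=set0 -> 0 < t -> t <= 1 ->
  mink t C K `<=` C -> K `<=` C.
Proof.
move=> cC [q Cq] t0 t1 CKC x Kx.
have step n : exists2 c, C c & `|c - x| <= (1 - t) ^+ n * `|q - x|.
  elim: n => [|n [c Cc cx]]; first by exists q => //; rewrite expr0 mul1r.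
  exists ((1 - t) *: c + t *: x); first by apply: CKC; exists c => //; exists x.
  have -> : (1 - t) *: c + t *: x - x = (1 - t) *: (c - x).
    by apply/rowP => i; rewrite !mxE; ring.
  by rewrite normrZ ger0_norm ?subr_ge0// exprS -mulrA ler_wpM2l ?subr_ge0.
apply: closed_limit (compact_is_closed cC) _ => e e0.
have [||n nP] := @mulr_pow_small _ (1 - t) `|q - x| e _ _ e0.
  by rewrite subr_ge0.
  by rewrite ltrBlDr ltrDl.
by have [k Kk kx] := step n; exists k => //; apply: le_trans kx nP.
Qed.
End Minkowski.

(** If A < N, Bernoulli gives (N / A)^k >= 1 + k / A, stated without denominators in [bern]; at k =
    A * B this exceeds [B]. *)
Lemma pow_le_base (N A B : nat) : (0 < A)%N ->
  (forall k, N ^ k <= A ^ k * B)%N -> (N <= A)%N.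
Proof.
move=> A0 NAB; rewrite leqNgt; apply/negP => AN.
have bern k : (A ^ k * (A + k) <= A * N ^ k)%N.
  elim: k => [|k IHk]; first by rewrite !expn0 mul1n muln1 addn0.
  apply: (@leq_trans (A.+1 * (A * N ^ k))); last first.
    by rewrite expnS mulnCA leq_mul2l leq_mul2r AN !orbT.
  apply: leq_trans (leq_mul (leqnn A.+1) IHk).
  by rewrite expnS; set P := (A ^ k)%N; nia.
have := bern (A * B)%N; have := NAB (A * B)%N; set P := (N ^ _)%N; set Q := (A ^ _)%N.
have Q0 : (0 < Q)%N by rewrite expn_gt0 A0.
by nia.
Qed.

(** * Discrete subgroups and their classes modulo 2 *)

Section Discrete.
Variables (R : realType) (d : nat).
Local Notation vec := 'rV[R]_d.
Variables (G : set vec) (r : R).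
Hypothesis G_sub : is_subgroup G.
Hypothesis r_gt0 : 0 < r.
Hypothesis G_gap : forall x, G x -> x <> 0 -> r <= `|x|.

Let G0 : G 0. Proof. by case: G_sub. Qed.

Lemma subgroupB x y : G x -> G y -> G (x - y). Proof. by case: G_sub => _; apply. Qed.
Lemma subgroupN x : G x -> G (- x).
Proof. by move=> Gx; rewrite -sub0r; exact: subgroupB. Qed.
Lemma subgroupD x y : G x -> G y -> G (x + y).
Proof. by move=> Gx Gy; rewrite -[y]opprK; apply: subgroupB => //; exact: subgroupN. Qed.

(** Index of the cube of side [r] containing x. For norm at most n * r the shifted coordinates lie
    in [0, 2n], hence 2n + 1 indices per axis; two points in one cube are closer than the gap
    [r]. *)
Definition cell (n : nat) (x : vec) : {ffun 'I_d -> 'I_(n + n).+1} :=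
  [ffun i => inord (Num.truncn (x 0 i / r + n%:R))].

Lemma cell_inj n x y : G x -> G y -> `|x| <= n%:R * r -> `|y| <= n%:R * r ->
  cell n x = cell n y -> x = y.
Proof.
move=> Gx Gy xn yn xy; apply/subr0_eq; apply: contrapT => xy0.
suff : `|x - y| < r by rewrite ltNge G_gap//; exact: subgroupB.
have b (z : vec) i : `|z| <= n%:R * r -> 0 <= z 0 i / r + n%:R <= (n + n)%:R.
  move=> zn; have : `|z 0 i| <= n%:R * r by apply: le_trans zn; exact: coord_le_norm.
  rewrite ler_norml => /andP[z1 z2]; apply/andP; split.
    by rewrite -lerBlDr sub0r ler_pdivlMr// mulNr.
  by rewrite natrD lerD2r ler_pdivrMr.
have e (z : vec) i : `|z| <= n%:R * r ->
    nat_of_ord (cell n z i) = Num.truncn (z 0 i / r + n%:R).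
  move=> zn; rewrite ffunE inordK// ltnS; have /andP[z1 z2] := b z i zn.
  by rewrite -(ler_nat R); apply: le_trans z2; rewrite truncn_le.
apply: norm_lt_coord => // i; rewrite !mxE.
have := e x i xn; rewrite xy (e y i yn) => E.
have /andP[x0 _] := b x i xn; have /andP[y0 _] := b y i yn.
have /andP[x1 x2] := truncn_itv x0; have /andP[y1 y2] := truncn_itv y0.
rewrite E in y1 y2; move: x1 x2 y1 y2.
rewrite -natr1; set T := (Num.truncn _)%:R => x1 x2 y1 y2.
have {}x2 : x 0 i / r - y 0 i / r < 1 by lra.
have {}y2 : - 1 < x 0 i / r - y 0 i / r by lra.
move: x2 y2; rewrite -mulrBl ltr_pdivrMr// mul1r => x2.
by rewrite ltr_pdivlMr// mulN1r => y2; rewrite ltr_norml y2.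
Qed.

Lemma nat_scale (M : R) : exists n : nat, M <= n%:R * r.
Proof.
exists (Num.truncn (`|M| / r)).+1; rewrite -ler_pdivrMr//.
apply: ltW; apply: le_lt_trans (truncnS_gt _).
by rewrite ler_pM2r ?invr_gt0// ler_norm.
Qed.

Lemma finite_in_ball (M : R) : finite_set (G `&` [set x | `|x| <= M]).
Proof.
have [n Mn] := nat_scale M; set A := (X in finite_set X).
have inj : {in A &, injective (cell n)}.
  move=> x y; rewrite !inE => -[Gx xM] [Gy yM]; apply: cell_inj => //.
    exact: le_trans Mn.
  exact: le_trans Mn.
have := inj_card_eq inj => /eq_finite_set <-.
exact: sub_finite_set (@finite_finset _ setT).
Qed.

Definition congr2 (x y : vec) := exists2 z, G z & x - y = 2 *: z.

(** Horner form of the sum of 2^j s (a j): a binary expansion with digits among the [s i]. *)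
Fixpoint word N (s : 'I_N -> vec) k : ('I_k -> 'I_N) -> vec :=
  if k is k'.+1 then fun a => s (a ord0) + 2 *: @word N s k' (fun j => a (lift ord0 j))
  else fun=> 0.

Lemma word_in N (s : 'I_N -> vec) k a : (forall i, G (s i)) -> G (@word N s k a).
Proof.
move=> Gs; elim: k a => [//|k IHk] a /=.
by rewrite scaler_nat mulr2n; do ?[apply: subgroupD => //].
Qed.

Lemma word_norm N (s : 'I_N -> vec) k a (m : R) : 0 <= m ->
  (forall i, `|s i| <= m) -> `|@word N s k a| <= (2 ^ k)%:R * m.
Proof.
move=> m0 sm; suff : `|@word N s k a| <= ((2 ^ k)%:R - 1) * m.
  by move=> /le_trans; apply; rewrite ler_wpM2r// gerBl.
elim: k a => [|k IHk] a /=; first by rewrite normr0 subrr mul0r.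
apply: le_trans (ler_normD _ _) _; rewrite normrZ ger0_norm//.
have := IHk (fun j => a (lift ord0 j)); have := sm (a ord0).
by rewrite expnS natrM; set W := `|word _ _| => h1 h2; nra.
Qed.

(** Modulo 2 a word reduces to its first digit, which incongruence recovers; cancelling that digit
    and halving leaves a shorter word. *)
Lemma word_inj N (s : 'I_N -> vec) k a b : (forall i, G (s i)) ->
  (forall i j, congr2 (s i) (s j) -> i = j) ->
  @word N s k a = @word N s k b -> a =1 b.
Proof.
move=> Gs s_inj; elim: k a b => [a b _ [] //|k IHk] a b /= E.
set a' := (fun j => a (lift ord0 j)) in E *; set b' := (fun j => b (lift ord0 j)) in E.
have ab0 : a ord0 = b ord0.
  apply: s_inj; exists (word s b' - word s a').
    by apply: subgroupB; exact: word_in.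
  have -> : s (a ord0) = s (b ord0) + 2 *: word s b' - 2 *: word s a'.
    by rewrite -E addrK.
  by rewrite scalerBr addrAC [s _ + _]addrC addrK.
have two0 : (2 : R) != 0 by rewrite pnatr_eq0.
move: E; rewrite ab0 => /addrI/(scalerI two0)/IHk ab' j.
by case: (unliftP ord0 j) => [j'|] -> //; exact: ab'.
Qed.

(* The N ^ k words are distinct points of G in a ball of radius O(2 ^ k), which contains only
   O(2 ^ (d k)) points of G. *)
Lemma mod2_count N (s : 'I_N -> vec) : (forall i, G (s i)) ->
  (forall i j, congr2 (s i) (s j) -> i = j) -> (N <= 2 ^ d)%N.
Proof.
move=> Gs s_inj.
have [m m0 sm] : exists2 m : R, 0 <= m & forall i, `|s i| <= m.
  exists (\sum_(i < N) `|s i|); first by apply: sumr_ge0.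
  by move=> i; rewrite (bigD1 i)//= lerDl sumr_ge0.
have [n mn] := nat_scale m.
apply: (@pow_le_base _ _ ((n + n).+1 ^ d)); first by rewrite expn_gt0.
move=> k; pose f (a : {ffun 'I_k -> 'I_N}) := cell (2 ^ k * n) (@word N s k a).
have wk (a : {ffun 'I_k -> 'I_N}) : `|@word N s k a| <= (2 ^ k * n)%:R * r.
  apply: le_trans (word_norm a m0 sm) _.
  by rewrite natrM -mulrA ler_wpM2l.
have finj : injective f.
  move=> a b /cell_inj ab; apply/ffunP; apply: (@word_inj N s) => //.
  by apply: ab => //; exact: word_in.
have := leq_card f finj; rewrite !card_ffun !card_ord => /leq_trans; apply.
have [->|d0] := posnP d; first by rewrite !expn0 exp1n.
rewrite -expnM [(d * k)%N]mulnC expnM -expnMn leq_exp2r//.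
by have : (0 < 2 ^ k)%N; [rewrite expn_gt0|set P := (2 ^ k)%N; nia].
Qed.

Lemma congr2_refl x : congr2 x x.
Proof. by exists 0 => //; rewrite subrr scaler0. Qed.

Lemma congr2_sym x y : congr2 x y -> congr2 y x.
Proof.
by move=> [z Gz xy]; exists (- z); [exact: subgroupN|rewrite scalerN -xy opprB].
Qed.

Lemma congr2_trans y x z : congr2 x y -> congr2 y z -> congr2 x z.
Proof.
move=> [a Ga xy] [b Gb yz]; exists (a + b); first exact: subgroupD.
by rewrite scalerDr -xy -yz addrA subrK.
Qed.

(** The common count of both upper bounds: [f] will be the width directions of the vertices, then
    the longest directions of the facets. *)
Lemma antipodal_count n (f : 'I_n -> vec) : (forall i, G (f i)) -> injective f ->
  (forall i j, congr2 (f i) (f j) -> f j = f i \/ f j = - f i) ->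
  (forall i, ~ congr2 (f i) 0) -> (n <= 2 ^ d.+1 - 2)%N.
Proof.
move=> Gf f_inj f_pm f_odd.
(* The least index in a class serves as its canonical representative. *)
pose rho (i : 'I_n) : 'I_n := [arg min_(j < i | `[< congr2 (f i) (f j) >]) (j : nat)].
have rhoP i : congr2 (f i) (f (rho i)) /\
    forall j, congr2 (f i) (f j) -> (rho i <= j)%N.
  rewrite /rho; case: arg_minnP => [|j /asboolP ij jmin].
    exact/asboolP/congr2_refl.
  by split=> // k /asboolP; exact: jmin.
have rho_eq i j : congr2 (f (rho i)) (f (rho j)) -> rho i = rho j.
  move=> ij; have [i1 i2] := rhoP i; have [j1 j2] := rhoP j.
  apply/val_inj/eqP; rewrite eqn_leq i2 ?j2//.
    exact: congr2_trans j1 (congr2_sym ij).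
  exact: congr2_trans i1 ij.
pose T := rho @: 'I_n.
(* Adding 0 to the representatives accounts for the zero class, so #|T| <= 2^d - 1. *)
pose s (i : 'I_#|T|.+1) := oapp (fun j => f (enum_val j)) 0 (unlift ord0 i).
have Trho (k : 'I_#|T|) : exists i, enum_val k = rho i.
  by have /imsetP[i _ ->] := enum_valP k; exists i.
have sle : (#|T|.+1 <= 2 ^ d)%N.
  apply: (@mod2_count _ s) => [i|i j].
    by rewrite /s; case: unliftP => [k _|_] //=.
  rewrite /s; case: unliftP => [k ->|->] /=; case: unliftP => [l ->|->] //=.
  - have [i' ki] := Trho k; have [j' lj] := Trho l; rewrite ki lj => /rho_eq.
    by rewrite -ki -lj => /enum_val_inj ->.
  - by move/f_odd.
  - by move/congr2_sym/f_odd.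
(* A class together with a sign determines [f i], hence i. *)
pose g (i : 'I_n) := (rho i, f i == f (rho i)).
have g_inj : injective g.
  move=> i j [ij]; rewrite /g ij => E; apply: f_inj.
  have [+ _] := rhoP i; have [+ _] := rhoP j; rewrite ij => /f_pm jr /f_pm ir.
  have [fi|fi] := eqVneq (f i) (f (rho j)).
    by move: E; rewrite fi eqxx => /esym/eqP ->.
  have [fj|fj] := eqVneq (f j) (f (rho j)).
    by move: E; rewrite fj eqxx (negbTE fi).
  case: ir => [/esym/eqP|ir]; first by rewrite (negbTE fi).
  case: jr => [/esym/eqP|jr]; first by rewrite (negbTE fj).
  by apply: oppr_inj; rewrite -ir -jr.
have gT : g @: 'I_n \subset finset.setX T [set: bool]%SET.
  by apply/fintype.subsetP => _ /imsetP[i _ ->]; rewrite finset.in_setX /= imset_f ?inE.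
have := subset_leq_card gT; rewrite card_imset// cardsX finset.cardsT card_ord card_bool.
move=> nT; rewrite expnS; lia.
Qed.
End Discrete.

(** * Reduced bodies *)

Section FiniteSets.

Lemma finite_enum (T : eqType) (A : set T) : finite_set A ->
  exists n (f : 'I_n -> T), injective f /\ forall x, A x <-> exists i, x = f i.
Proof.
move=> /finite_seqP[s ->]; case: s => [|x0 s'].
  exists 0%N; have f : 'I_0 -> T by case.
  by exists f; split=> [[]//|x]; split=> // -[[]].
set s := x0 :: s'; exists (size (undup s)), (fun i => nth x0 (undup s) i).
split=> [i j ij|x].
  apply/val_inj/eqP; have := nth_uniq x0 (ltn_ord i) (ltn_ord j) (undup_uniq s).
  by rewrite ij eqxx => <-.
rewrite /= -mem_undup; split=> [xs|[i ->]]; last exact: mem_nth.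
have xi : (index x (undup s) < size (undup s))%N by rewrite index_mem.
by exists (Ordinal xi); rewrite /= nth_index.
Qed.

Lemma finite_gap (R : realType) (T : eqType) (A : set T) (g : T -> R) (w : R) :
  finite_set A -> (forall a, A a -> w < g a) ->
  exists2 e : R, 0 < e & forall a, A a -> w + e <= g a.
Proof.
move=> /finite_seqP[s ->]; elim: s => [|x s IHs] wg.
  by exists 1 => // a; rewrite /= in_nil.
have [|e e0 es] := IHs; first by move=> a /= sa; apply: wg; rewrite /= in_cons sa orbT.
have wx : w < g x by apply: wg; rewrite /= mem_head.
exists (Num.min e (g x - w)); first by rewrite lt_min e0 subr_gt0.
move=> a; rewrite /= in_cons => /orP[/eqP ->|sa].
  by rewrite -lerBrDl ge_min lexx orbT.
by apply: le_trans (es a sa); rewrite lerD2l ge_min lexx.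
Qed.
End FiniteSets.

Section Width.
Variables (R : realType) (d : nat).
Local Notation vec := 'rV[R]_d.
Implicit Types (x y z u v : vec) (C K L : set vec).

Lemma body_neq0 C : convex_body C -> C !=set0.
Proof. by move=> [_ [_ [q /interior_subset Cq]]]; exists q. Qed.

Lemma width_dirP C y : compact C -> C !=set0 -> exists a b,
  [/\ C a, C b, forall x, C x -> dotp y x <= dotp y a,
      forall x, C x -> dotp y b <= dotp y x & width_dir C y = dotp y (a - b)].
Proof.
move=> cC C0; have [a Ca amax] := compact_argmax y cC C0.
have [b Cb bmax] := compact_argmax (- y) cC C0.
have bmin x : C x -> dotp y b <= dotp y x.
  by move=> /bmax; rewrite !dotpNl lerN2.
exists a, b; split => //; apply/eqP; rewrite eq_le; apply/andP; split.
  apply: ge_sup; first by exists (dotp y (a - b)), a, b.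
  by move=> _ [a' [b' [Ca' [Cb' ->]]]]; rewrite !dotpBr lerB ?amax ?bmin.
apply: ub_le_sup; last by exists a, b.
exists (dotp y (a - b)) => _ [a' [b' [Ca' [Cb' ->]]]].
by rewrite !dotpBr lerB ?amax ?bmin.
Qed.

Lemma width_dir_ge C y a b : compact C -> C a -> C b -> dotp y (a - b) <= width_dir C y.
Proof.
move=> cC Ca Cb; have [|a' [b' [_ _ amax bmin ->]]] := @width_dirP C y cC.
  by exists a.
by rewrite !dotpBr lerB ?amax ?bmin.
Qed.

Lemma width_dir_ge0 C y : compact C -> C !=set0 -> 0 <= width_dir C y.
Proof. by move=> cC [a Ca]; rewrite -(dotp0r y) -(subrr a) width_dir_ge. Qed.

(** Moving the centre of a ball in [C] by r along axis i, in the direction of the sign of y_i, gains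
    r |y_i|. With a gap in the dual lattice this leaves finitely many dual vectors of bounded
    width. *)
Lemma body_width_ge C : convex_body C ->
  exists2 r : R, 0 < r & forall y, r * `|y| <= width_dir C y.
Proof.
move=> [cC [_ [q Cq]]]; have [r r0 rC] := interior_ball Cq.
have Cq' : C q by exact: interior_subset.
exists r => // y; rewrite mulrC -ler_pdivlMr//; apply: norm_le_coord.
  by apply: divr_ge0 (ltW r0); apply: width_dir_ge0 => //; exists q.
move=> i; rewrite ler_pdivlMr//.
have -> : `|y 0 i| * r = dotp y (q + (r * Num.sg (y 0 i)) *: delta_mx 0 i - q).
  by rewrite [q + _]addrC addrK dotpZr dotp_delta -mulrA -normrEsg mulrC.
apply: width_dir_ge => //; apply: rC; apply: norm_le_coord; first exact: ltW.
move=> j; rewrite !mxE eqxx /= normrM normrM (gtr0_norm r0) -mulrA ler_piMr ?(ltW r0)//.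
rewrite mulr_ile1 // ?normr_sg; case: (y 0 i != 0) => //=; case: (j == i) => //=.
all: by rewrite ?normr0 ?normr1.
Qed.

Lemma lattice_width_le L C y : convex_body C -> dual_lattice L y -> y <> 0 ->
  lattice_width L C <= width_dir C y.
Proof.
move=> bC Ly y0; apply: ge_inf; last by exists y.
by exists 0 => _ [z [_ [_ ->]]]; apply: width_dir_ge0; [case: bC|exact: body_neq0].
Qed.

Lemma lattice_width_ge0 L C : convex_body C -> 0 <= lattice_width L C.
Proof.
move=> bC; rewrite /lattice_width; set S := (X in inf X).
have [->|S0] := eqVneq S set0; first by rewrite inf0.
apply: lb_le_inf; first exact/set0P.
by move=> _ [z [_ [_ ->]]]; apply: width_dir_ge0; [case: bC|exact: body_neq0].
Qed.

Lemma lattice_width_eq L C K : convex_body C -> convex_body K -> K `<=` C ->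
  (forall y, dual_lattice L y -> y <> 0 -> lattice_width L C <= width_dir K y) ->
  lattice_width L K = lattice_width L C.
Proof.
move=> bC bK KC wK; have [[y [Ly y0]]|noy] := pselect (exists y, dual_lattice L y /\ y <> 0).
  apply/eqP; rewrite eq_le; apply/andP; split.
    apply: lb_le_inf; first by exists (width_dir C y), y.
    move=> _ [z [Lz [z0 ->]]]; apply: le_trans (lattice_width_le bK Lz z0) _.
    have [cK _] := bK; have [a [b [Ka Kb _ _ ->]]] := width_dirP z cK (body_neq0 bK).
    by apply: width_dir_ge; [case: bC|exact: KC|exact: KC].
  apply: lb_le_inf; first by exists (width_dir K y), y.
  by move=> _ [z [Lz [z0 ->]]]; exact: wK.
have E (X : set vec) : [set w | exists y, dual_lattice L y /\ y <> 0 /\ w = width_dir X y] = set0.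
  by apply/seteqP; split => // w [y [Ly [y0 _]]]; apply: noy; exists y.
by rewrite /lattice_width !E.
Qed.

Lemma dual_subgroup L : is_subgroup (dual_lattice L).
Proof.
split=> [x _|x y Lx Ly z Lz]; first by rewrite dotp0r rpred0.
by rewrite dotpBr rpredB ?Lx ?Ly.
Qed.

(** Write the i-th unit vector as a combination of lattice vectors s_j. If y_i is nonzero, some
    integer s_j . y is nonzero, so 1 <= |s_j . y|, which is at most a constant times |y|. *)
Lemma dual_gap L : spans L ->
  exists2 r : R, 0 < r & forall y, dual_lattice L y -> y <> 0 -> r <= `|y|.
Proof.
move=> sL.
have MP (i : 'I_d) : exists M : R, 0 <= M /\
    forall y, dual_lattice L y -> y 0 i <> 0 -> 1 <= M * `|y|.
  have [n [s [c [Ls ec]]]] := sL (delta_mx 0 i).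
  exists (\sum_(j < n) \sum_(k < d) `|s j 0 k|); split.
    by apply: sumr_ge0 => j _; exact: sumr_ge0.
  move=> y Ly yi; have [j sj] : exists j, dotp (s j) y <> 0.
    apply: contrapT => /forallNP H; apply: yi; rewrite -dotp_delta ec dotp_sumr.
    by apply: big1 => j _; rewrite dotpZr dotpC; have /contrapT -> := H j; rewrite mulr0.
  apply: (@le_trans _ _ `|dotp (s j) y|).
    by apply: norm_intr_ge1; [exact: Ly|exact/eqP].
  apply: le_trans (dotp_le_norm _ _) _; rewrite ler_wpM2r//.
  by rewrite [leRHS](bigD1 j)//= lerDl; apply: sumr_ge0 => k _; exact: sumr_ge0.
have [M MM] := choice MP.
exists (1 + \sum_i M i)^-1.
  by rewrite invr_gt0 ltr_wpDr// sumr_ge0// => i _; case: (MM i).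
move=> y Ly y0; have [i yi] : exists i, y 0 i <> 0.
  apply: contrapT => /forallNP H; apply: y0; apply/rowP => i.
  by rewrite mxE; have /contrapT := H i.
have S0 : 0 < 1 + \sum_i M i by rewrite ltr_wpDr// sumr_ge0// => j _; case: (MM j).
rewrite -[leLHS]mul1r ler_pdivrMr//; have [Mi /(_ y Ly yi)] := MM i.
move=> /le_trans; apply; rewrite mulrC ler_wpM2l// (bigD1 i)//= addrCA lerDl.
by rewrite addr_ge0// sumr_ge0// => j _; case: (MM j).
Qed.

Lemma lattice_gap L : is_lattice L ->
  exists2 r : R, 0 < r & forall y, L y -> y <> 0 -> r <= `|y|.
Proof.
move=> [[L0 _] [/(_ 0 L0)[r r0 rL] _]]; exists (r / d.+1%:R); first by rewrite divr_gt0.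
move=> y Ly y0; rewrite ler_pdivrMr// mulrC.
by apply: le_trans (enorm_le_norm y); have := rL y Ly y0; rewrite subr0.
Qed.

Definition width_direction L C y :=
  [/\ dual_lattice L y, y <> 0 & width_dir C y = lattice_width L C].

Lemma finite_width_le L C (M : R) : is_lattice L -> convex_body C ->
  finite_set (dual_lattice L `&` [set y | width_dir C y <= M]).
Proof.
move=> [_ [_ sL]] bC; have [r r0 rL] := dual_gap sL; have [s s0 sC] := body_width_ge bC.
apply: sub_finite_set (finite_in_ball (dual_subgroup L) r0 rL (M / s)) => y [Ly yM].
by split => //=; rewrite ler_pdivlMr// mulrC; exact: le_trans yM.
Qed.

(** Only finitely many dual vectors have width at most w + 1, so the non-minimal ones among them
    have a common margin; all others have margin 1. *)
Lemma width_gap L C : is_lattice L -> convex_body C -> exists2 e : R, 0 < e &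
  forall y, dual_lattice L y -> y <> 0 ->
    width_direction L C y \/ lattice_width L C + e <= width_dir C y.
Proof.
move=> lL bC; set w := lattice_width L C.
have [e e0 eP] : exists2 e : R, 0 < e & forall y,
    (dual_lattice L `&` [set y | width_dir C y <= w + 1] `&` [set y | w < width_dir C y]) y ->
    w + e <= width_dir C y.
  apply: finite_gap => [|y []//]; apply: finite_setIl.
  exact: finite_width_le.
exists (Num.min e 1); first by rewrite lt_min e0 ltr01.
move=> y Ly y0; have := lattice_width_le bC Ly y0; rewrite le_eqVlt => /orP[/eqP wy|wy].
  by left.
right; have [y1|y1] := leP (width_dir C y) (w + 1).
  by apply: le_trans (eP y _); rewrite // lerD2l ge_min lexx.
by apply: le_trans (ltW y1); rewrite lerD2l ge_min lexx orbT.
Qed.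

Lemma reduced_core L C K : is_lattice L -> convex_body C -> lattice_reduced L C ->
  compact K -> convex_set K -> K !=set0 -> K `<=` C ->
  (forall y, width_direction L C y -> width_dir C y <= width_dir K y) -> C = K.
Proof.
move=> lL bC redC cK xK K0 KC wK; have [cC [xC _]] := bC.
have [e e0 eP] := width_gap lL bC; set w := lattice_width L C in eP.
have w0 : 0 <= w by exact: lattice_width_ge0.
(* This gives (1 - t)(w + e) >= w, so directions above the gap keep width [w] even where [K] has
   width 0. The summand 1 ensures t < 1 when w = 0. *)
pose t := e / (w + e + 1).
have D0 : 0 < w + e + 1 by lra.
have t0 : 0 < t by rewrite divr_gt0.
have t1 : t < 1 by rewrite ltr_pdivrMr// mul1r; lra.
have te : t * (w + e) <= e.
  by rewrite /t mulrAC ler_pdivrMr// ler_wpM2l// ?(ltW e0)// lerDl.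
have bM : convex_body (mink t C K) by exact: mink_body.
have MC : mink t C K `<=` C.
  move=> _ [c Cc [k Kk ->]]; apply: xC => //; first exact: KC.
  by rewrite !ltW.
have wM y : (1 - t) * width_dir C y + t * width_dir K y <= width_dir (mink t C K) y.
  have [a [b [Ca Cb _ _ ->]]] := width_dirP y cC (body_neq0 bC).
  have [k [l [Kk Kl _ _ ->]]] := width_dirP y cK K0.
  have -> : (1 - t) * dotp y (a - b) + t * dotp y (k - l) =
      dotp y (((1 - t) *: a + t *: k) - ((1 - t) *: b + t *: l)).
    by rewrite !dotpE; ring.
  apply: width_dir_ge; [by case: bM|by exists a => //; exists k|].
  by exists b => //; exists l.
apply/seteqP; split => //.
apply: (sub_mink_sub cC (body_neq0 bC) t0 (ltW t1)) => //.
  exact: compact_is_closed.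
apply: contrapT => CM; apply: redC; exists (mink t C K); split => //; split => //.
apply: lattice_width_eq => // y Ly y0; apply: le_trans (wM y); rewrite -/w.
have wKy : 0 <= width_dir K y by exact: width_dir_ge0.
case: (eP y Ly y0) => [Yy|wy].
  have := wK y Yy; case: Yy => _ _; rewrite -/w => -> wy; nra.
by nra.
Qed.

(** Deleting an extreme point from a convex set leaves it convex; if no [p i] were [v], the
    punctured hull would already contain the whole hull. *)
Lemma vertex_conv_hull n (p : 'I_n -> vec) v :
  is_vertex (conv_hull p) v -> exists i, v = p i.
Proof.
move=> [Pv vP]; apply: contrapT => /forallNP vp.
have cv : convex_set (conv_hull p `&` [set x | x <> v]).
  move=> x y t [Px xv] [Py yv] /andP[t0 t1]; split.
    by apply: conv_hull_convex => //; rewrite t0.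
  move=> /= /esym E; have [t00|t00] := eqVneq t 0.
    by move: E; rewrite t00 subr0 scale1r scale0r addr0 => /esym.
  have [t11|t11] := eqVneq t 1.
    by move: E; rewrite t11 subrr scale1r scale0r add0r => /esym.
  have xy : x = y.
    by apply: vP E => //; rewrite !lt_def t00 t0 eq_sym t11 t1.
  by apply: xv; rewrite E -xy -scalerDl subrK scale1r.
suff [_] : (conv_hull p `&` [set x | x <> v]) v by apply.
apply: (conv_hull_sub cv) Pv => i; split; first exact: conv_hull_mem.
by move=> /esym; exact: vp.
Qed.

Definition is_argmax C y a := C a /\ forall x, C x -> dotp y x <= dotp y a.

Lemma width_argmax C y a b : compact C -> C !=set0 -> C a -> C b ->
  width_dir C y <= dotp y (a - b) -> is_argmax C y a /\ is_argmax C (- y) b.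
Proof.
move=> cC C0 Ca Cb wab; have [a' [b' [Ca' Cb' amax bmin wE]]] := width_dirP y cC C0.
have := amax a Ca; have := bmin b Cb; move: wab; rewrite wE !dotpBr => h1 h2 h3.
split; split=> // x Cx; first by have := amax x Cx; lra.
by rewrite !dotpNl; have := bmin x Cx; lra.
Qed.

Lemma width_directionN L C y : width_direction L C y -> width_direction L C (- y).
Proof.
move=> [Ly y0 wy]; split => //.
- exact: (subgroupN (dual_subgroup L)).
- by move=> /eqP; rewrite oppr_eq0 => /eqP.
rewrite -wy; congr sup; apply/seteqP.
by split => _ [a [b [Ca [Cb ->]]]]; exists b, a; rewrite -opprB dotpNr ?dotpNl ?opprK.
Qed.

Lemma argmax_width C y a b : compact C -> is_argmax C y a -> is_argmax C (- y) b ->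
  width_dir C y <= dotp y (a - b).
Proof.
move=> cC [Ca amax] [Cb bmin].
have [|a' [b' [Ca' Cb' _ _ ->]]] := width_dirP y cC; first by exists a.
have := amax a' Ca'; have := bmin b' Cb'; rewrite !dotpNl !dotpBr; lra.
Qed.

Lemma finite_width_directions L C : is_lattice L -> convex_body C ->
  finite_set (width_direction L C).
Proof.
move=> lL bC; apply: sub_finite_set (finite_width_le (lattice_width L C) lL bC) => y.
by move=> [Ly _ wy]; split => //=; rewrite wy.
Qed.

(** Width directions come in pairs y, - y, so one maximizer for each already realises the full
    width. The point [q] keeps the hull non-empty. *)
Lemma reduced_conv_hull L C (p : vec -> vec) q : is_lattice L -> convex_body C ->
  lattice_reduced L C -> C q ->
  (forall y, width_direction L C y -> is_argmax C y (p y)) ->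
  exists n (f : 'I_n -> vec), C = conv_hull f /\
    forall i, f i = q \/ exists2 y, width_direction L C y & f i = p y.
Proof.
move=> lL bC redC Cq pP; have [n [g [_ gP]]] := finite_enum (finite_width_directions lL bC).
pose f (i : 'I_n.+1) := oapp (fun j => p (g j)) q (unlift ord0 i).
have fP i : f i = q \/ exists2 y, width_direction L C y & f i = p y.
  rewrite /f; case: unliftP => [j _|_]; last by left.
  by right; exists (g j) => //; apply/gP; exists j.
have fp y : width_direction L C y -> exists i, f i = p y.
  by move=> /gP[j ->]; exists (lift ord0 j); rewrite /f liftK.
exists n.+1, f; split => //; have [cC [xC _]] := bC.
apply: (reduced_core lL bC redC).
- exact: conv_hull_compact.
- exact: conv_hull_convex.
- by exists (f ord0); exact: conv_hull_mem.
- apply: conv_hull_sub => // i; case: (fP i) => [->//|[y /pP[Cp _] ->//]].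
move=> y Yy; have Yy' := width_directionN Yy.
apply: le_trans (argmax_width cC (pP _ Yy) (pP _ Yy')) _.
have [i <-] := fp _ Yy; have [j <-] := fp _ Yy'.
by apply: width_dir_ge; [exact: conv_hull_compact|exact: conv_hull_mem..].
Qed.

Lemma body_two_points C v : (0 < d)%N -> convex_body C -> exists2 q, C q & q <> v.
Proof.
move=> d0 [_ [_ [q Cq]]]; have [r r0 rC] := interior_ball Cq.
have [<-|qv] := pselect (q = v); last by exists q => //; exact: interior_subset.
exists (q + const_mx r).
  by apply: rC; apply: norm_le_coord (ltW r0) _ => i; rewrite mxE gtr0_norm.
move=> /eqP; rewrite -subr_eq0 addrAC subrr add0r => /eqP/rowP/(_ (Ordinal d0)).
by rewrite !mxE => r00; rewrite r00 ltxx in r0.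
Qed.

(** Otherwise maximizers other than [v], together with a point q <> v, would generate [C], although
    a vertex must be among the generators. *)
Lemma reduced_vertex L C v : (0 < d)%N -> is_lattice L -> convex_body C ->
  lattice_reduced L C -> is_vertex C v ->
  exists2 y, width_direction L C y & forall a, is_argmax C y a -> a = v.
Proof.
move=> d0 lL bC redC vC; apply: contrapT => H; have [cC _] := bC.
have pP y : exists a, width_direction L C y -> is_argmax C y a /\ a <> v.
  have [Yy|] := pselect (width_direction L C y); last by exists 0.
  apply: contrapT => /forallNP Hy; apply: H; exists y => // a aP.
  by apply: contrapT => av; apply: (Hy a).
have [p {}pP] := choice pP.
have [q Cq qv] := body_two_points v d0 bC.
have [|n [f [CE fP]]] := reduced_conv_hull lL bC redC Cq (p := p).
  by move=> y /pP[].
rewrite CE in vC; have [i vi] := vertex_conv_hull vC.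
case: (fP i) => [fq|[y Yy fy]]; first by apply: qv; rewrite -fq vi.
by have [_] := pP y Yy; apply; rewrite -fy vi.
Qed.

Theorem reduced_polytope L C : (0 < d)%N -> is_lattice L -> convex_body C ->
  lattice_reduced L C ->
  is_polytope C /\ exists n, (n <= 2 ^ d.+1 - 2)%N /\ num_vertices_eq C n.
Proof.
move=> d0 lL bC redC; have [cC _] := bC; have C0 := body_neq0 bC.
have [q Cq] := C0.
have pP y : exists a, is_argmax C y a.
  by have [a Ca aP] := compact_argmax y cC C0; exists a.
have [p {}pP] := choice pP.
have [n [f [CE _]]] := reduced_conv_hull lL bC redC Cq (fun y _ => pP y).
split; first by exists n, f.
have [|m [g [g_inj gP]]] := @finite_enum _ (is_vertex C).
  apply: (@sub_finite_set _ _ (range f)); last by apply: finite_image; exact: finite_finset.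
  by rewrite CE => v /vertex_conv_hull[i ->]; exists i.
exists m; split; last by exists g.
have yP i : exists y, width_direction L C y /\ forall a, is_argmax C y a -> a = g i.
  have [|y Yy yi] := reduced_vertex (v := g i) d0 lL bC redC.
    by apply/gP; exists i.
  by exists y.
have [y {}yP] := choice yP.
have [_ [_ sL]] := lL; have [r r0 rL] := dual_gap sL.
have [s s0 sC] := body_width_ge bC.
have w0 z : width_direction L C z -> 0 < lattice_width L C.
  move=> [_ z0 <-]; apply: lt_le_trans (sC z); rewrite mulr_gt0// normr_gt0.
  exact/eqP.
have dG := dual_subgroup L.
apply: (antipodal_count dG r0 rL (f := y)).
- by move=> i; case: (yP i) => -[].
- move=> i j ij; apply: g_inj.
  by rewrite -((yP i).2 _ (pP _)) -((yP j).2 _ (pP _)) ij.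
- move=> i j [z Lz yz]; apply: contrapT => /not_orP[ji jNi].
  have [[Li yi0 wi] iP] := yP i; have [[Lj yj0 wj] jP] := yP j.
  have zw (z' : vec) : dual_lattice L z' -> z' <> 0 -> exists2 ab : vec * vec,
      C ab.1 /\ C ab.2 & lattice_width L C <= dotp z' (ab.1 - ab.2).
    move=> Lz' z'0; have [a [b [Ca Cb _ _ E]]] := width_dirP z' cC C0.
    by exists (a, b) => //=; rewrite -E; exact: lattice_width_le.
  have Lzj : dual_lattice L (z + y j) by exact: (subgroupD dG).
  have yi : y i = 2 *: z + y j by rewrite -yz subrK.
  have z0 : z <> 0 by move=> z0; apply: ji; rewrite yi z0 scaler0 add0r.
  have zj0 : z + y j <> 0.
    move=> /eqP; rewrite addr_eq0 => /eqP zE; apply: jNi.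
    by rewrite yi zE scalerN scaler_nat mulr2n opprD opprK addrK.
  (* Let w be the lattice width. Since 2 z = y i - y j, the pair gives 2 w <= y i . (a - b) - y j .
     (a - b) <= 2 w, and equality makes [a] a maximizer of [y i] and of [- y j]. Likewise [a']
     maximizes [y i] and [y j], because 2 (z + y j) = y i + y j. *)
  have [[a b] /= [Ca Cb] zab] := zw z Lz z0.
  have [[a' b'] /= [Ca' Cb'] zab'] := zw _ Lzj zj0.
  have := width_dir_ge (y i) cC Ca Cb; have := width_dir_ge (- y j) cC Ca Cb.
  have := width_dir_ge (y i) cC Ca' Cb'; have := width_dir_ge (y j) cC Ca' Cb'.
  have [_ _ wNj] := width_directionN (And3 Lj yj0 wj).
  rewrite wi wj wNj yi !dotpNl !(dotpDl, dotpZl) => h1 h2 h3 h4.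
  rewrite dotpDl in zab'.
  have [ai _] := @width_argmax C (y i) a b cC C0 Ca Cb ltac:(rewrite wi yi dotpDl dotpZl; lra).
  have [aj _] := @width_argmax C (- y j) a b cC C0 Ca Cb ltac:(rewrite wNj dotpNl; lra).
  have [a'i _] := @width_argmax C (y i) a' b' cC C0 Ca' Cb' ltac:(rewrite wi yi dotpDl dotpZl; lra).
  have [a'j _] := @width_argmax C (y j) a' b' cC C0 Ca' Cb' ltac:(rewrite wj; lra).
  have aa' : a = a' by rewrite (iP a ai) (iP a' a'i).
  (* At a = a' the functional [y j] is both minimal and maximal, so its width would be 0. *)
  have := w0 (y j) (And3 Lj yj0 wj); rewrite -wj.
  have [c [e [Cc Ce _ _ ->]]] := width_dirP (y j) cC C0.
  have := aj.2 e Ce; have := a'j.2 c Cc; rewrite -aa' !dotpNl dotpBr; lra.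
(* If y i = 2 z, its width is twice that of a nonzero dual vector, hence above the minimum. *)
- move=> i [z Lz]; rewrite subr0 => yz; have [[Li yi0 wi] _] := yP i.
  have z0 : z <> 0 by move=> z0; apply: yi0; rewrite yz z0 scaler0.
  have [a [b [Ca Cb _ _ E]]] := width_dirP z cC C0.
  have := lattice_width_le bC Lz z0; rewrite E => h.
  have := width_dir_ge (y i) cC Ca Cb; have := w0 (y i) (And3 Li yi0 wi).
  rewrite wi {1}yz dotpZl; lra.
Qed.
End Width.

(** * Polyhedra and supporting functionals *)

(** With g a common slack and S the sum of the |b i|, the step g / (1 + S + g) changes each side by
    at most g; the 1 keeps the step below 1. *)
Lemma small_perturbation (R : realType) (I : finType) (a b : I -> R) :
  (forall i, a i < 0) -> exists2 e : R, 0 < e < 1 & forall i, a i + e * b i <= 0.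
Proof.
move=> a0; have [||g g0 gP] := @finite_gap R I setT (fun i => - a i) 0.
- exact: finite_finset.
- by move=> i _; rewrite oppr_gt0.
pose S := \sum_i `|b i|.
have S0 : 0 <= S by exact: sumr_ge0.
have D0 : 0 < 1 + S + g by lra.
exists (g / (1 + S + g)); first by rewrite divr_gt0//= ltr_pdivrMr// mul1r; lra.
move=> i; have := gP i Logic.I; rewrite add0r => ga.
suff : g / (1 + S + g) * b i <= g by lra.
rewrite mulrAC ler_pdivrMr// ler_wpM2l// ?(ltW g0)//.
apply: le_trans (ler_norm _) _; have : `|b i| <= S by rewrite /S (bigD1 i)//= lerDl sumr_ge0.
by lra.
Qed.

Section Polyhedra.
Variables (R : realType) (d : nat).
Local Notation vec := 'rV[R]_d.
Variables (I : finType) (u : I -> vec) (h : I -> R).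
Implicit Types (x y z v w : vec).

Definition polyhedron : set vec := [set x | forall i, dotp (u i) x <= h i].

Lemma polyhedron_closed : closed polyhedron.
Proof.
have -> : polyhedron = [set x | forall i, setT i -> dotp (u i) x <= h i].
  by apply/seteqP; split => x xP i //; exact: xP.
exact: halfspaces_closed.
Qed.

Lemma polyhedron_convex : convex_set polyhedron.
Proof.
move=> x y t xP yP /andP[t0 t1] i; rewrite !dotpE.
have := xP i; have := yP i; nra.
Qed.

Definition tight x : {set I} := [set i | dotp (u i) x == h i]%SET.

(** Boundedness forces some constraint to increase along [w]; the ray leaves where the smallest
    ratio [F i] is reached, possibly at s = 0. *)
Lemma ray_exit (M : R) x w : (forall y, polyhedron y -> `|y| <= M) ->
  polyhedron x -> w <> 0 -> exists2 s : R, 0 <= s & polyhedron (x + s *: w) /\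
    exists2 i, 0 < dotp (u i) w & i \in tight (x + s *: w).
Proof.
move=> bM Px w0; have [i0 i0P] : exists i, 0 < dotp (u i) w.
  apply: contrapT => /forallNP H; have wn : 0 < `|w| by rewrite normr_gt0; exact/eqP.
  pose s := (M + `|x| + 1) / `|w|.
  have M0 : 0 <= M by apply: le_trans (bM x Px).
  have s0 : 0 <= s by rewrite divr_ge0// ?addr_ge0.
  have /bM : polyhedron (x + s *: w).
    move=> i; rewrite !dotpE; have := Px i; have /negP := H i; rewrite -leNgt; nra.
  have := ler_normB (x + s *: w) x; rewrite addrAC subrr add0r normrZ ger0_norm//.
  by rewrite divfK ?gt_eqF//; lra.
pose F i := (h i - dotp (u i) x) / dotp (u i) w.
case: (@Order.TotalTheory.arg_minP _ _ _ i0 (fun i => 0 < dotp (u i) w) F i0P) => i iP imin.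
have F0 : 0 <= F i by apply: divr_ge0 (ltW iP); rewrite subr_ge0; exact: Px.
exists (F i) => //.
split; last first.
  exists i => //; rewrite inE !dotpE /F divfK; last by rewrite gt_eqF.
  by rewrite addrC subrK.
move=> j; rewrite !dotpE.
have [jP|jP] := ltP 0 (dotp (u j) w); last by have := Px j; nra.
have := imin j jP; rewrite {2}/F ler_pdivlMr//; lra.
Qed.

(** Vertices are the points whose tight constraints have no common kernel vector ([isolated]). From
    any other point a kernel vector [w] leads both ways to points with more tight constraints, and
    the point lies between them. *)
Lemma bounded_polyhedron_polytope (M : R) :
  (forall y, polyhedron y -> `|y| <= M) -> is_polytope polyhedron.
Proof.
move=> bM; have [[x0 Px0]|P0] := pselect (polyhedron !=set0); last first.
  exists 0%N, (fun=> 0); apply/seteqP; split => x; first by move=> Px; case: P0; exists x.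
  by move=> [a [_ []]]; rewrite big_ord0 => /eqP; rewrite eq_sym oner_eq0.
pose isolated x := forall w, (forall i, i \in tight x -> dotp (u i) w = 0) -> w = 0.
have vP (A : {set I}) : exists x, polyhedron x /\
    forall y, polyhedron y -> tight y = A -> isolated y -> y = x.
  have [[x [Px [xA xi]]]|H] := pselect (exists x, polyhedron x /\ tight x = A /\ isolated x).
    exists x; split=> // y Py yA yi; apply/subr0_eq/yi => i iA.
    have : i \in tight x by rewrite xA -yA.
    by move: iA; rewrite !inE dotpBr => /eqP -> /eqP ->; rewrite subrr.
  by exists x0; split => // y Py yA yi; case: H; exists y.
have [v {}vP] := choice vP.
pose f (i : 'I_#|{set I}|) := v (enum_val i).
exists #|{set I}|, f; apply/seteqP; split; last first.
  apply: conv_hull_sub polyhedron_convex _ => i; exact: (vP _).1.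
suff H n x : polyhedron x -> (#|~: tight x| <= n)%N -> conv_hull f x.
  by move=> x Px; exact: (H _ x Px (leqnn _)).
elim: n x => [|n IHn] x Px xn; have [xi|] := pselect (isolated x).
- have -> : x = f (enum_rank (tight x)) by rewrite /f enum_rankK; exact: (vP _).2.
  exact: conv_hull_mem.
- move=> /existsNP[w /not_implyP[wP w0]]; have [s s0 [_ [i iw _]]] := ray_exit bM Px w0.
  move: iw; rewrite wP ?ltxx//; move: xn; rewrite leqn0 cards_eq0 => /eqP xn.
  by apply/negPn/negP => it; have := finset.in_set0 i; rewrite -xn finset.in_setC it.
- have -> : x = f (enum_rank (tight x)) by rewrite /f enum_rankK; exact: (vP _).2.
  exact: conv_hull_mem.
move=> /existsNP[w /not_implyP[wP w0]].
have ext z : z <> 0 -> (forall i, i \in tight x -> dotp (u i) z = 0) ->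
    exists2 s : R, 0 < s & conv_hull f (x + s *: z).
  move=> z0 zP; have [s s0 [Ps [i iz it]]] := ray_exit bM Px z0.
  have ix : i \notin tight x by apply/negP => /zP iz0; rewrite iz0 ltxx in iz.
  exists s.
    rewrite lt_def s0 andbT; apply: contra ix => /eqP s00.
    by move: it; rewrite s00 scale0r addr0.
  apply: IHn => //; rewrite -ltnS; apply: leq_trans xn; apply: proper_card.
  apply/fintype.properP; split.
    apply/fintype.subsetP => j; rewrite !finset.in_setC; apply: contra => jt.
    by rewrite inE !dotpE zP// mulr0 addr0; move: jt; rewrite inE.
  by exists i; rewrite finset.in_setC ?it.
have [s s0 hs] := ext w w0 wP.
have [||s' s'0 hs'] := ext (- w).
- by move=> /eqP; rewrite oppr_eq0 => /eqP.
- by move=> i /wP iw; rewrite dotpNr iw oppr0.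
have D0 : 0 < s + s' by rewrite addr_gt0.
have -> : x = (1 - s / (s + s')) *: (x + s *: w) + (s / (s + s')) *: (x + s' *: - w).
  by apply/rowP => i; rewrite !mxE; field; rewrite gt_eqF.
apply: conv_hull_convex => //.
by rewrite divr_ge0 ?(ltW s0) ?(ltW D0)//= ler_pdivrMr// mul1r lerDl ltW.
Qed.

(** Some constraint is tight at the barycentre [m] of the [p k], else [m] could be pushed along [v]
    beyond [c]. A constraint tight at the average is tight at every [p k], and the [p k] span a
    single hyperplane. *)
Lemma facet_normal (p : 'I_d -> vec) v (c : R) : (0 < d)%N -> polyhedron° !=set0 ->
  (forall i, u i <> 0) -> v <> 0 -> (forall x, polyhedron x -> dotp v x <= c) ->
  (forall k, polyhedron (p k)) -> (forall k, dotp v (p k) = c) -> aff_indep p ->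
  exists i, exists2 l : R, 0 < l & v = l *: u i /\ c = l * h i.
Proof.
move=> d0 [q Pq] u0 v0 vc Pp pc ap.
have dR : (d%:R : R) != 0 by rewrite pnatr_eq0 -lt0n.
pose m := \sum_(k < d) (d%:R^-1 : R) *: p k.
have s1 : \sum_(k < d) (d%:R^-1 : R) = 1 by rewrite sumr_const card_ord -[LHS]mulr_natl divff.
have Pm : polyhedron m.
  by apply: convex_sum polyhedron_convex _ s1 Pp => i; rewrite invr_ge0.
have mE z : dotp z m = d%:R^-1 * \sum_(k < d) dotp z (p k).
  by rewrite dotp_sumr mulr_sumr; apply: eq_bigr => k _; rewrite dotpZr.
have vm : dotp v m = c.
  rewrite mE (eq_bigr (fun=> c)) // sumr_const card_ord -(mulr_natl c) mulrA mulVf//.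
  by rewrite mul1r.
have [i im] : exists i, dotp (u i) m = h i.
  apply: contrapT => /forallNP H.
  have lt i : dotp (u i) m - h i < 0.
    by rewrite subr_lt0 lt_neqAle Pm andbT; apply/eqP.
  have [e /andP[e0 _] eP] := small_perturbation (fun i => dotp (u i) v) lt.
  have : polyhedron (m + e *: v).
    by move=> i; rewrite !dotpE; have := eP i; lra.
  move=> /vc; rewrite !dotpE vm; have := dotp_gt0 v0; nra.
have ip k : dotp (u i) (p k) = h i.
  apply/eqP; rewrite eq_sym -subr_eq0; apply/eqP.
  have : \sum_(k < d) (h i - dotp (u i) (p k)) = 0.
    rewrite sumrB sumr_const card_ord -mulr_natl -im mE mulrA divff//.
    by rewrite mul1r subrr.
  move/eqP; rewrite psumr_eq0 => [/allP/(_ k)|k' _]; last by rewrite subr_ge0; exact: Pp.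
  by rewrite mem_index_enum => /(_ isT)/eqP.
(* Affine independence of the [p k] is linear independence of the rows (p k, 1), so affine
   functionals vanishing on all [p k] form a line. *)
pose A : 'M[R]_(d, d + 1) := row_mx (\matrix_k p k) (const_mx 1).
have Afree : row_free A.
  rewrite -kermx_eq0; apply/eqP/row_matrixP => k; rewrite row0.
  set a := row k _; have : a *m A = 0 by rewrite /a -row_mul mulmx_ker row0.
  rewrite mul_mx_row => /eqP; rewrite -row_mx0 => /eqP/eq_row_mx[a1 a2].
  apply/rowP => l; rewrite [RHS]mxE; apply: (ap (fun l => a 0 l)).
    have := congr1 (fun X : 'M[R]_1 => X 0 0) a2; rewrite !mxE => E; rewrite -[RHS]E.
    by apply: eq_bigr => j _; rewrite [const_mx _ _ _]mxE mulr1.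
  by rewrite -[RHS]a1 mulmx_sum_row; apply: eq_bigr => j _; rewrite rowK.
pose r1 : 'rV[R]_(d + 1) := row_mx v (const_mx (- c)).
pose r2 : 'rV[R]_(d + 1) := row_mx (u i) (const_mx (- h i)).
have ker z b : (forall k, dotp z (p k) = b) ->
    (row_mx z (const_mx (- b)) <= kermx A^T)%MS.
  move=> zb; apply/sub_kermxP; rewrite tr_row_mx mul_row_col; apply/rowP => k.
  rewrite !mxE (eq_bigr (fun j => z 0 j * p k 0 j)) => [|j _]; last by rewrite !mxE.
  by rewrite -/(dotp z (p k)) zb big_ord1 !mxE mulr1 subrr.
have k1 := ker _ _ pc; have k2 := ker _ _ ip.
have rk : \rank (kermx A^T) = 1%N.
  by rewrite mxrank_ker mxrank_tr (eqP Afree) addKn.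
have r20 : r2 != 0.
  apply/eqP => /eqP; rewrite -row_mx0 => /eqP/eq_row_mx[ui0 _].
  exact: (u0 i).
have : (r1 <= r2)%MS.
  apply: submx_trans k1 _; rewrite -(geq_leqif (mxrank_leqif_sup k2)) rk.
  by rewrite lt0n mxrank_eq0.
move=> /sub_rVP[l]; rewrite /r1 /r2 scale_row_mx => /eq_row_mx[vE cE].
have {}cE : c = l * h i.
  by apply: oppr_inj; have := congr1 (fun X : 'rV_1 => X 0 0) cE; rewrite !mxE mulrN.
exists i, l => //.
(* The sign of [l] is read off at an interior point, where v . q < c strictly. *)
have [r r0 rP] := interior_ball Pq.
have Pq' : polyhedron q by exact: interior_subset.
have vq : dotp v q < c.
  have vn : 0 < `|v| by rewrite normr_gt0; exact/eqP.
  have : polyhedron (q + (r / `|v|) *: v).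
    have s0 : 0 < r / `|v| by rewrite divr_gt0.
    by apply: rP; rewrite normrZ gtr0_norm// divfK// gt_eqF.
  move/vc; rewrite !dotpE; have := dotp_gt0 v0; have : 0 < r / `|v| by rewrite divr_gt0.
  by set s := r / _; nra.
have := Pq' i; move: vq; rewrite vE cE dotpZl => h1 h2.
have : 0 < l * (h i - dotp (u i) q) by rewrite mulrBr subr_gt0.
by apply: contraLR; rewrite -!leNgt => l0; rewrite mulr_le0_ge0 ?subr_ge0.
Qed.
End Polyhedra.

(** * Separation and supporting functionals *)

Section Support.
Variables (R : realType) (d : nat).
Local Notation vec := 'rV[R]_d.
Implicit Types (x y u v w : vec) (K : set vec).

(* The normal is x - k0, where k0 is the point of K nearest to x. *)
Lemma strict_separation K x : compact K -> convex_set K -> K !=set0 -> ~ K x ->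
  exists u, forall k, K k -> dotp u k < dotp u x.
Proof.
move=> cK xK K0 Kx; pose f (y : vec) : R := dotp y y + dotp (- (2 *: x)) y.
have cf : continuous f.
  have cq : continuous (fun y : vec => \sum_(i < d) y 0 i * y 0 i).
    apply: sum_continuous => i z.
    have c := @coord_continuous R 1 d 0 i z; exact: (cvgM c c).
  have -> : f = (fun y : vec => \sum_(i < d) y 0 i * y 0 i) \+ dotp (- (2 *: x)) by [].
  by move=> y; apply: continuousD; [exact: cq|exact: dotp_continuous].
have [|k0] := @EVT_min_rV _ _ f _ K0 cK; first exact: continuous_subspaceT.
rewrite inE => Kk0 k0min; exists (x - k0) => k Kk.
have xk0 : 0 < dotp (x - k0) (x - k0).
  by apply: dotp_gt0 => /subr0_eq xE; apply: Kx; rewrite xE.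
suff : dotp (x - k0) (k - k0) <= 0 by move: xk0; rewrite !dotpBr; lra.
have [w wE] : exists w, w = k - k0 by exists (k - k0).
rewrite -wE leNgt; apply/negP; set a := dotp _ w => a0.
have w0 := dotp_ge0 w; set b := dotp w w in w0.
pose t := a / (a + b); have ab : 0 < a + b by lra.
have t0 : 0 < t by rewrite divr_gt0.
have t1 : t <= 1 by rewrite ler_pdivrMr// mul1r; lra.
have tb : t * b <= a by rewrite mulrAC ler_pdivrMr// ler_wpM2l ?(ltW a0)// lerDr ltW.
have : f k0 <= f (k0 + t *: w).
  apply: k0min; rewrite inE; have -> : k0 + t *: w = (1 - t) *: k0 + t *: k.
    by rewrite wE; apply/rowP => i; rewrite !mxE; ring.
  by apply: xK => //; rewrite t1 ltW.
have aE : a = dotp x w - dotp k0 w by rewrite /a dotpBl.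
rewrite /f !dotpE -/b (dotpC w k0); nra.
Qed.

Lemma sphere_compact : compact [set u : vec | `|u| = 1].
Proof.
apply: bounded_closed_compact.
  by exists 1; split; [exact: num_real|move=> M M1 u /= ->; exact: ltW].
have -> : [set u : vec | `|u| = 1] = (fun u => `|u|) @^-1` [set 1 : R] by [].
apply: preimage_closed; last exact: closed_eq.
by move=> u _; exact: norm_continuous.
Qed.

(** Strictly separate (1 + 1/(n+1)) p from [K] by unit normals; a cluster point of these on the
    compact sphere supports [K] at [p]. *)
Lemma supporting_functional K p : compact K -> convex_set K -> K !=set0 ->
  (forall l : R, 1 < l -> ~ K (l *: p)) ->
  exists2 u, u <> 0 & forall k, K k -> dotp u k <= dotp u p.
Proof.
move=> cK xK K0 pK.
pose e n : R := n.+1%:R^-1.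
have e0 n : 0 < e n by rewrite invr_gt0.
have uP n : exists u, `|u| = 1 /\ forall k, K k -> dotp u k < dotp u ((1 + e n) *: p).
  have [|u uK] := strict_separation cK xK K0 (pK (1 + e n) _); first by rewrite ltrDl.
  have [k Kk] := K0; have un : 0 < `|u|.
    by rewrite normr_gt0; apply/eqP => u0; have := uK k Kk; rewrite u0 !dotp0l ltxx.
  exists (`|u|^-1 *: u); split.
    by rewrite normrZ ger0_norm ?invr_ge0// mulVf// gt_eqF.
  by move=> k' Kk'; rewrite !dotpZl ltr_pM2l ?invr_gt0// uK.
have [u {}uP] := choice uP.
have [|v [v1 vcl]] := sphere_compact (F := u @ \oo) _.
  by exists 0%N => // n _ /=; exact: (uP n).1.
exists v => [v0|k Kk]; first by move: v1; rewrite /= v0 normr0 => /eqP; rewrite eq_sym oner_eq0.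
rewrite -subr_le0 -dotpBr; apply/ler_addgt0Pl => s s0; rewrite addr0.
pose A := [set w : vec | dotp (k - p) w <= s].
have Acl : closed A by exact: halfspace_closed.
suff : A v by rewrite /A /= dotpC.
rewrite ((closure_id A).1 Acl) => B Bv; apply: vcl Bv.
pose S := \sum_(i < d) `|p 0 i|.
have S0 : 0 <= S by exact: sumr_ge0.
(* Unit normals have |dotp (u n) p| <= S, so from this index on the error [e n * dotp (u n) p] is at
   most [s]. *)
exists (Num.truncn (S / s)) => // n /= nS; rewrite /A /= dotpC dotpBr.
have [un /(_ k Kk)] := uP n; rewrite dotpZr mulrDl mul1r => h1.
suff : e n * dotp (u n) p <= s by lra.
rewrite /e mulrC ler_pdivrMr//.
have : `|dotp (u n) p| <= S by rewrite dotpC -[S]mulr1 -un; exact: dotp_le_norm.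
move=> /(le_trans (ler_norm _)) /le_trans; apply.
rewrite mulrC -ler_pdivrMr//; apply: le_trans (ltW (truncnS_gt _)) _.
by rewrite ler_nat ltnS.
Qed.
End Support.

(** * Lattice lengths and complete bodies *)

Section LatticeLength.
Variables (R : realType) (d : nat).
Local Notation vec := 'rV[R]_d.
Implicit Types (a b x y z u v w : vec) (C K L : set vec).

Lemma finite_argmin (T : eqType) (A : set T) (g : T -> R) (a0 : T) :
  finite_set A -> A a0 ->
  exists2 m, A m & forall a : T, A a -> g m <= g a.
Proof.
move=> /finite_seqP[s ->]; elim: s a0 => [//|x s IHs] a0 _.
case: s IHs => [_|y s IHs].
  by exists x; rewrite /= ?mem_seq1// => a; rewrite inE => /eqP ->.
have [|m ms mP] := IHs y; first by rewrite /= mem_head.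
have [xm|mx] := leP (g x) (g m).
  exists x; first by rewrite /= mem_head.
  by move=> a; rewrite /= in_cons => /orP[/eqP ->//|/mP]; exact: le_trans.
exists m; first by move: ms; rewrite /= [in X in _ -> X]in_cons => ->; rewrite orbT.
by move=> a; rewrite /= in_cons => /orP[/eqP ->|/mP//]; exact: ltW.
Qed.

Lemma subgroup_intmul L (k : int) x : is_subgroup L -> L x -> L (k%:~R *: x).
Proof.
move=> sL Lx; have Ln (n : nat) : L (n%:R *: x).
  elim: n => [|n IHn]; first by rewrite scale0r; case: sL.
  by rewrite -natr1 scalerDl scale1r; exact: subgroupD.
case: k => n; first exact: Ln.
by rewrite NegzE mulrNz scaleNr; apply: subgroupN => //; exact: Ln.
Qed.

(** The generator is the least t v in [L] with 0 < t <= 1, which exists by finiteness. Measured by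
    it a segment only gets longer, so the diameter may be tested on arbitrary lattice vectors. *)
Lemma vI_exists L a b v (l : R) : is_lattice L -> L v -> v <> 0 -> 0 < l ->
  b - a = l *: v -> exists m, exists2 l', l <= l' & is_vI L a b m /\ b - a = l' *: m.
Proof.
move=> lL Lv v0 l0 ab; have [r r0 rL] := lattice_gap lL.
have [sL _] := lL.
pose A := [set x | L x /\ exists2 t : R, 0 < t <= 1 & x = t *: v].
have fA : finite_set A.
  apply: sub_finite_set (finite_in_ball sL r0 rL `|v|) => x [Lx [t /andP[t0 t1] xE]].
  by split=> //; rewrite /= xE normrZ gtr0_norm// ler_piMl.
have Av : A v by split => //; exists 1; rewrite ?ltr01 ?lexx// scale1r.
have [m [Lm [t0 /andP[t0_gt0 t0_le1] mE]] mP] := finite_argmin (dotp v) fA Av.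
have vv := dotp_gt0 v0.
have gen (t : R) : L (t *: v) -> exists k : int, t = k%:~R * t0.
  move=> Lt; exists (Num.floor (t / t0)); set k := Num.floor _.
  have /andP[k1 k2] := floor_itv (t / t0).
  rewrite ler_pdivlMr// in k1; rewrite intrD ltr_pdivrMr// mulrDl mul1r in k2.
  have [//|ne] := eqVneq t (k%:~R * t0).
  have : A ((t - k%:~R * t0) *: v).
    split; last first.
      exists (t - k%:~R * t0) => //; rewrite subr_gt0 lt_neqAle eq_sym ne k1/=.
      by rewrite lerBlDl; apply: le_trans (ltW k2) _; rewrite lerD2l.
    rewrite scalerBl -scalerA -mE; apply: subgroupB => //; exact: subgroup_intmul.
  by move=> /mP; rewrite mE !dotpZr ler_pM2r// leNgt ltrBlDl k2.
exists m, (l / t0); first by rewrite ler_pdivlMr// ler_piMr// ltW.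
have t00 : t0 != 0 by rewrite gt_eqF.
have l00 : l != 0 by rewrite gt_eqF.
split; last by rewrite ab mE scalerA divfK.
split => //; split.
  exists (t0 / l); first by rewrite divr_gt0.
  by rewrite ab mE scalerA divfK.
move=> u Lu [t uE]; move: Lu; rewrite uE ab scalerA => /gen[k ->].
by exists k; rewrite mE scalerA.
Qed.

Lemma lattice_lengthE L a b (l : R) : lattice_length L a b l -> a <> b ->
  exists v, [/\ L v, v <> 0, 0 <= l & b - a = l *: v].
Proof.
move=> [v [[Lv [[s s0 vE] _]] ->]] ab.
have ba : b - a <> 0 by move=> /subr0_eq /esym.
have v0 : v <> 0.
  by move=> v0; apply: ba; apply/eqP; move/eqP: vE; rewrite v0 eq_sym scaler_eq0 gt_eqF.
exists v; split => //; first by rewrite divr_ge0// enorm_ge0.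
have E : enorm v = s * enorm (b - a) by rewrite vE enormZ gtr0_norm.
have n0 := enorm_gt0 ba.
have -> : enorm (b - a) / enorm v = s^-1 by rewrite E; field; rewrite !gt_eqF.
by rewrite vE scalerA mulVf ?scale1r// gt_eqF.
Qed.

(** For convex [C], a translate of the segment from 0 to x fits in [C] exactly when x lies here;
    lengths become statements about one symmetric body. *)
Definition difference_body C : set vec :=
  [set x | exists2 a, C a & exists2 b, C b & x = b - a].

Lemma difference_body_compact C : compact C -> compact (difference_body C).
Proof.
move=> cC; have -> : difference_body C = (fun p : vec * vec => p.2 - p.1) @` (C `*` C).
  apply/seteqP; split => [_ [c Cc [k Kk ->]]|_ [[c k] [Cc Kk] <-]].
    by exists (c, k).
  by exists c => //; exists k.
apply: continuous_compact; last exact: compact_setX.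
by apply: continuous_subspaceT => p; apply: cvgB; [exact: cvg_snd|exact: cvg_fst].
Qed.

Lemma difference_body_convex C : convex_set C -> convex_set (difference_body C).
Proof.
move=> cC _ _ s [a Ca [b Cb ->]] [a' Ca' [b' Cb' ->]] s01.
exists ((1 - s) *: a + s *: a'); first exact: cC.
exists ((1 - s) *: b + s *: b'); first exact: cC.
by apply/rowP => i; rewrite !mxE; ring.
Qed.

Lemma difference_bodyN C x : difference_body C x -> difference_body C (- x).
Proof. by move=> [a Ca [b Cb ->]]; exists b => //; exists a => //; rewrite opprB. Qed.

Lemma difference_body_ball C : convex_body C ->
  exists2 r : R, 0 < r & forall x, `|x| <= r -> difference_body C x.
Proof.
move=> [_ [_ [q Cq]]]; have [r r0 rC] := interior_ball Cq.
exists r => // x xr; exists q; first exact: interior_subset.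
by exists (q + x); [exact: rC|rewrite addrAC subrr add0r].
Qed.

Lemma length_bounded L C : is_lattice L -> convex_body C -> exists2 B : R, 0 <= B &
  forall v l, L v -> v <> 0 -> difference_body C (l *: v) -> l <= B.
Proof.
move=> lL bC; have [r r0 rL] := lattice_gap lL.
have [M M0 MK] := compact_norm_bound (difference_body_compact bC.1).
exists (M / r); first by rewrite divr_ge0 ?ltW.
move=> v l Lv v0 /MK; rewrite normrZ => lM; rewrite ler_pdivlMr//.
apply: le_trans lM; have := rL v Lv v0 => rv.
apply: (@le_trans _ _ (`|l| * r)); first by rewrite ler_wpM2r ?ler_norm// ltW.
exact: ler_wpM2l.
Qed.
End LatticeLength.

Section Diameter.
Variables (R : realType) (d : nat).
Local Notation vec := 'rV[R]_d.
Variables (L C : set vec).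
Hypotheses (lL : is_lattice L) (bC : convex_body C).
Implicit Types (a b x y z u v w : vec).
Local Notation D := (lattice_diam L C).
Local Notation K := (difference_body C).

Let lengths : set R := [set l | exists a b, segment_in C a b /\
  is_lattice_segment L a b /\ lattice_length L a b l].

Let lengthsP l : lengths l -> exists v, [/\ L v, v <> 0, 0 <= l & K (l *: v)].
Proof.
move=> [a [b [sC [[ab _] /lattice_lengthE/(_ ab)[v [Lv v0 l0 E]]]]]].
exists v; split => //; rewrite -E; exists a.
  by have := sC 0; rewrite subr0 scale1r scale0r addr0; apply; rewrite lexx ler01.
exists b => //.
by have := sC 1; rewrite subrr scale1r scale0r add0r; apply; rewrite lexx ler01.
Qed.

Let lengths_ub : has_ubound lengths.
Proof.
have [B _ BP] := length_bounded lL bC.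
by exists B => l /lengthsP[v [Lv v0 _]]; exact: BP.
Qed.

Lemma diam_ge0 : 0 <= D.
Proof.
have [E|/set0P[l Sl]] := eqVneq lengths set0.
  by rewrite /lattice_diam -/lengths E sup0.
have [v [_ _ l0 _]] := lengthsP Sl.
exact: le_trans l0 (ub_le_sup lengths_ub Sl).
Qed.

Lemma diam_ge v l : L v -> v <> 0 -> K (l *: v) -> l <= D.
Proof.
move=> Lv v0 [a Ca [b Cb /esym ab]]; have [l0|l0] := leP l 0.
  exact: le_trans l0 diam_ge0.
have [m [l' ll' [vI ab']]] := vI_exists lL Lv v0 l0 ab.
apply: (le_trans ll'); apply: ub_le_sup => //; exists a, b; split.
  by move=> t t01; case: bC => _ [cC _]; exact: cC.
have l'0 : 0 < l' by exact: lt_le_trans ll'.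
have nab : a <> b.
  move=> E; apply: v0; apply/eqP; move/eqP: ab.
  by rewrite E subrr eq_sym scaler_eq0 gt_eqF.
split; first by split => //; exists v; split => //; split => //; exists l.
exists m; split => //; have m0 : m <> 0.
  by move=> E; apply: nab; apply/esym/subr0_eq; rewrite ab' E scaler0.
by rewrite ab' enormZ gtr0_norm// mulfK// gt_eqF// enorm_gt0.
Qed.

Lemma diam_le M : 0 <= M ->
  (forall v l, L v -> v <> 0 -> K (l *: v) -> l <= M) -> D <= M.
Proof.
move=> M0 MP; have [E|/set0P S0] := eqVneq lengths set0.
  by rewrite /lattice_diam -/lengths E sup0.
by apply: ge_sup => // l /lengthsP[v [Lv v0 _]]; exact: MP.
Qed.

Definition longest_direction v := [/\ L v, v <> 0 & K (D *: v)].

Lemma longest_directionN v : longest_direction v -> longest_direction (- v).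
Proof.
move=> [Lv v0 Kv]; split; first by case: lL => sL _; exact: subgroupN.
  by move=> /eqP; rewrite oppr_eq0 => /eqP.
by rewrite scalerN; exact: difference_bodyN.
Qed.

Lemma diam_gt0 : (0 < d)%N -> 0 < D.
Proof.
move=> d0; have [v [Lv v0]] : exists v, L v /\ v <> 0.
  apply: contrapT => /forallNP H; have [_ [_ sL]] := lL.
  have [n [s [c [Ls /rowP/(_ (Ordinal d0))]]]] := sL (const_mx 1).
  rewrite big1 => [|i _]; first by rewrite !mxE => /eqP; rewrite oner_eq0.
  have -> : s i = 0 by apply: contrapT => si; apply: (H (s i)); split.
  by rewrite scaler0.
have [r r0 rK] := difference_body_ball bC.
have vn : 0 < `|v| by rewrite normr_gt0; exact/eqP.
apply: (@lt_le_trans _ _ (r / `|v|)); first by rewrite divr_gt0.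
apply: (diam_ge Lv v0); apply: rK; rewrite normrZ ger0_norm ?divr_ge0// ?(ltW r0)//.
by rewrite divfK// gt_eqF.
Qed.

Lemma max_length v : v <> 0 ->
  exists2 l, K (l *: v) & forall l', K (l' *: v) -> l' <= l.
Proof.
move=> v0; have cK := difference_body_compact bC.1.
have [M M0 MK] := compact_norm_bound cK; have [r r0 rK] := difference_body_ball bC.
have vn : 0 < `|v| by rewrite normr_gt0; exact/eqP.
pose S := [set l | K (l *: v)].
have S0 : S !=set0 by exists 0; rewrite /S /= scale0r; apply: rK; rewrite normr0 ltW.
have Sub : has_ubound S.
  exists (M / `|v|) => l /MK; rewrite normrZ ler_pdivlMr// => lM.
  by apply: le_trans lM; rewrite ler_wpM2r// ler_norm.
exists (sup S); last by move=> l' Sl'; exact: ub_le_sup.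
apply: closed_limit (compact_is_closed cK) _ => e e0.
have [|l Sl lP] := @sup_adherent _ S (e / `|v|) _ (conj S0 Sub); first by rewrite divr_gt0.
exists (l *: v) => //; rewrite -scalerBl normrZ distrC ger0_norm ?subr_ge0 ?ub_le_sup//.
by rewrite -ler_pdivlMr// lerBlDr -lerBlDl ltW.
Qed.

(** Long lattice vectors yield lengths at most D / 2. Finitely many vectors remain, and their
    maximal lengths are attained, so those below [D] have a common margin. *)
Lemma length_gap : (0 < d)%N -> exists2 e : R, 0 < e < D & forall v, L v -> v <> 0 ->
  longest_direction v \/ forall l, K (l *: v) -> l <= D - e.
Proof.
move=> d0; have D0 := diam_gt0 d0; have [sL _] := lL; have [r r0 rL] := lattice_gap lL.
have [M M0 MK] := compact_norm_bound (difference_body_compact bC.1).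
have lP v : exists l, v <> 0 -> K (l *: v) /\ forall l', K (l' *: v) -> l' <= l.
  have [->|v0] := pselect (v = 0); first by exists 0.
  by have [l Kl lmax] := max_length v0; exists l.
have [l {}lP] := choice lP.
have [e e0 eP] : exists2 e : R, 0 < e & forall v, (L `&` [set v | `|v| <= M / (D / 2)] `&`
    [set v | v <> 0 /\ ~ longest_direction v]) v -> 0 + e <= D - l v.
  apply: finite_gap => [|v [[Lv _] [v0 nv]]].
    by apply: finite_setIl; exact: (finite_in_ball sL r0 rL).
  have [Kl _] := lP v v0; rewrite subr_gt0 lt_neqAle (diam_ge Lv v0 Kl) andbT.
  by apply/eqP => lD; apply: nv; split => //; rewrite -lD.
have D2 : 0 < D / 2 by rewrite divr_gt0.
exists (Num.min e (D / 2)).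
  by rewrite lt_min e0 D2/= gt_min [X in _ || X]ltr_pdivrMr// ltr_pMr// ltr1n orbT.
move=> v Lv v0; have [lv|nlv] := pselect (longest_direction v); [by left|right].
move=> l' Kl'; have [l'D|Dl'] := leP l' (D / 2).
  apply: le_trans l'D _; have : Num.min e (D / 2) <= D / 2 by rewrite ge_min lexx orbT.
  by lra.
have vM : `|v| <= M / (D / 2).
  rewrite ler_pdivlMr//; apply: le_trans (MK _ Kl'); rewrite normrZ mulrC ler_wpM2r//.
  by apply: le_trans (ler_norm _); exact: ltW.
have := eP v (conj (conj Lv vM) (conj v0 nlv)); have := (lP v v0).2 l' Kl'.
have : Num.min e (D / 2) <= e by rewrite ge_min lexx.
by lra.
Qed.
End Diameter.

(** * Slab descriptions and the facet bound *)

Section Complete.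
Variables (R : realType) (d : nat).
Local Notation vec := 'rV[R]_d.
Variables (L C : set vec).
Hypotheses (d_gt0 : (0 < d)%N) (lL : is_lattice L) (bC : convex_body C).
Implicit Types (a b x y z u v w : vec).
Local Notation D := (lattice_diam L C).
Local Notation K := (difference_body C).
Local Notation longest := (longest_direction L C).

Let D0 : 0 < D. Proof. exact: diam_gt0. Qed.

(** In the mixture [C'] of [C] and [E] longest directions gain nothing, as [C'] lies in [E]; the
    others stay within their gap for small t. Completeness gives C' = C, and [mink_sub_sub] carries
    the inclusion over to [E]. *)
Lemma complete_core (E : set vec) : lattice_complete L C ->
  compact E -> convex_set E -> C `<=` E ->
  (forall v l, longest v -> difference_body E (l *: v) -> l <= D) -> E `<=` C.
Proof.
move=> cmp cE xE CE EP; have [cC [xC _]] := bC; have C0 := body_neq0 bC.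
have [e /andP[e0 eD] eP] := length_gap lL bC d_gt0.
have [r r0 rK] := difference_body_ball bC.
have [B B0 BE] := compact_norm_bound (difference_body_compact cE).
(* [E - E] has radius at most [B] and [C - C] contains the ball of radius [r], so M (C - C) contains
   [E - E]. *)
pose M := B / r; have M0 : 0 < M by rewrite divr_gt0.
have EMK z : difference_body E z -> exists2 y, K y & z = M *: y.
  move=> Ez; exists (M^-1 *: z); last by rewrite scalerA mulfV ?scale1r// gt_eqF.
  apply: rK; rewrite normrZ gtr0_norm ?invr_gt0// mulrC ler_pdivrMr//.
  by rewrite mulrC divfK ?gt_eqF//; exact: BE.
have MD0 : 0 < M * D by rewrite mulr_gt0.
have MD : 0 < M * D + 1 + e by lra.
(* Differences of points of [C'] lie in (1 - t + t M)(C - C); as t M D <= e, the lengths (1 - t + t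
   M)(D - e) are at most [D]. *)
pose t := e / (M * D + 1 + e).
have t0 : 0 < t by rewrite divr_gt0.
have t1 : t < 1.
  by rewrite ltr_pdivrMr// mul1r; lra.
have tMD : t * (M * D) <= e.
  by rewrite mulrAC ler_pdivrMr// ler_wpM2l ?(ltW e0)//; lra.
pose C' := mink t C E.
have CC' : C `<=` C'.
  move=> x Cx; exists x => //; exists x; first exact: CE.
  by rewrite -scalerDl subrK scale1r.
have C'E : C' `<=` E.
  move=> _ [c Cc [k Ek ->]]; apply: xE => //; first exact: CE.
  by rewrite (ltW t0) (ltW t1).
have E0 : E !=set0 by case: C0 => x /CE; exists x.
have bC' : convex_body C' by exact: mink_body.
have t01 : 0 <= t <= 1 by rewrite (ltW t0) (ltW t1).
have KE x y : difference_body C x -> difference_body C y ->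
    difference_body C ((1 - t + t * M)^-1 *: ((1 - t) *: x + t *: (M *: y))).
  move=> Kx Ky; have tM0 : 0 < t * M by rewrite mulr_gt0.
  have s0 : 0 < 1 - t + t * M by lra.
  have := difference_body_convex xC Kx Ky (t := t * M / (1 - t + t * M)).
  have -> : (1 - t * M / (1 - t + t * M)) *: x + (t * M / (1 - t + t * M)) *: y =
      (1 - t + t * M)^-1 *: ((1 - t) *: x + t *: (M *: y)).
    by apply/rowP => i; rewrite !mxE; field; rewrite gt_eqF.
  apply; apply/andP; split; first by apply: divr_ge0; lra.
  by rewrite ler_pdivrMr// mul1r; lra.
have DD : lattice_diam L C' = D.
  apply/eqP; rewrite eq_le; apply/andP; split; last first.
    apply: diam_le; first exact: diam_ge0.
    move=> v l Lv v0 [a Ca [b Cb E']]; apply: (diam_ge lL bC' Lv v0).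
    by exists a; [exact: CC'|exists b => //; exact: CC'].
  apply: diam_le; first exact: ltW.
  move=> v l Lv v0 [a C'a [b C'b lE]]; case: (eP v Lv v0) => [lv|vP].
    by apply: (EP v) => //; exists a; [exact: C'E|exists b => //; exact: C'E].
  case: C'a lE => [c Cc [k Ek ->]]; case: C'b => [c' Cc' [k' Ek' ->]] lE.
  have Ekk : difference_body E (k' - k) by exists k => //; exists k'.
  have [z Kz zE] := EMK _ Ekk.
  have Kc : K (c' - c) by exists c => //; exists c'.
  have := KE _ _ Kc Kz; rewrite -zE; have -> : (1 - t) *: (c' - c) + t *: (k' - k) = l *: v.
    by rewrite lE; apply/rowP => i; rewrite !mxE; ring.
  have tM0 : 0 < t * M by rewrite mulr_gt0.
  have s0 : 0 < 1 - t + t * M by lra.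
  rewrite scalerA => /vP; rewrite mulrC ler_pdivrMr// => /le_trans; apply.
  by move: tMD; rewrite mulrA; nra.
apply: (mink_sub_sub cC C0 t0 (ltW t1)); rewrite -/C'.
by apply: contrapT => nC; apply: cmp; exists C'.
Qed.

Definition normal_at v u := u <> 0 /\ forall x, K x -> dotp u x <= dotp u (D *: v).

Lemma normal_exists v : longest v -> exists u, normal_at v u.
Proof.
move=> [Lv v0 Kv]; have [||||u u0 uP] := @supporting_functional _ _ K (D *: v).
- exact: difference_body_compact bC.1.
- exact: difference_body_convex bC.2.1.
- by exists (D *: v).
- by move=> l l1; rewrite scalerA => /(diam_ge lL bC Lv v0); rewrite leNgt ltr_pMl ?l1.
by exists u.
Qed.

Lemma normal_gt0 v u : normal_at v u -> 0 < dotp u v.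
Proof.
move=> [u0 uP]; have [r r0 rK] := difference_body_ball bC.
have un : 0 < `|u| by rewrite normr_gt0; exact/eqP.
have /uP : K ((r / `|u|) *: u).
  by apply: rK; rewrite normrZ gtr0_norm ?divr_gt0// divfK// gt_eqF.
rewrite !dotpZr => /(lt_le_trans _) h; rewrite -(pmulr_rgt0 _ D0); apply: h.
by rewrite mulr_gt0 ?divr_gt0// dotp_gt0.
Qed.

Lemma normalNN v u : normal_at v u -> normal_at (- v) (- u).
Proof.
move=> [u0 uP]; split; first by move=> /eqP; rewrite oppr_eq0 => /eqP.
move=> x /difference_bodyN /uP; rewrite !dotpE; lra.
Qed.

(** A functional maximal at the midpoint of two points of [C - C] is maximal at both. *)
Lemma normal_mid v w u : longest v -> longest w ->
  normal_at (2^-1 *: (v + w)) u -> normal_at v u /\ dotp u v = dotp u w.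
Proof.
move=> [_ _ Kv] [_ _ Kw] [u0 uP]; have := uP _ Kv; have := uP _ Kw.
rewrite !dotpE !ler_pM2l// => h1 h2.
have vw : dotp u v = dotp u w by lra.
split => //; split => // x /uP; rewrite !dotpE vw; lra.
Qed.

(* The normals un may be chosen freely; facet_direction exploits this freedom. *)
Lemma complete_slabs (n : nat) (g : 'I_n -> vec) (un : vec -> vec) :
  lattice_complete L C -> (forall v, longest v <-> exists i, v = g i) ->
  (forall v, longest v -> normal_at v (un v)) ->
  exists h : 'I_n * bool -> R,
    C = polyhedron (fun i => if i.2 then un (g i.1) else - un (g i.1)) h.
Proof.
move=> cmp gP unP; have [cC [xC _]] := bC.
have aP i : exists a, C a /\ C (a + D *: g i).
  have [_ _ [a Ca [b Cb E]]] : longest (g i) by apply/gP; exists i.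
  by exists a; split => //; rewrite E addrCA subrr addr0.
have [a {}aP] := choice aP.
pose nrm (i : 'I_n * bool) := if i.2 then un (g i.1) else - un (g i.1).
(* The slab lies between the parallel hyperplanes through the ends of a longest segment; both
   support [C] because the normal supports [C - C]. *)
pose h (i : 'I_n * bool) := if i.2 then dotp (un (g i.1)) (a i.1 + D *: g i.1)
  else - dotp (un (g i.1)) (a i.1).
exists h; rewrite -/nrm.
have lg i : longest (g i) by apply/gP; exists i.
have CP : C `<=` polyhedron nrm h.
  move=> x Cx [i bi]; rewrite /nrm /h /=; have [Ca Ca'] := aP i.
  have [_ uP] := unP _ (lg i).
  case: bi; last rewrite dotpNl lerN2.
    have /uP : K (x - a i) by exists (a i) => //; exists x.
    by rewrite dotpBr dotpDr; lra.
  have /uP : K (a i + D *: g i - x) by exists x => //; exists (a i + D *: g i).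
  by rewrite dotpBr dotpDr; lra.
apply/seteqP; split => // x0 Px0.
have [M M0 CM] := compact_norm_bound cC.
(* The intersection of the slabs is not known to be bounded, so it is cut by a ball containing [C]
   and [x0]. *)
pose B := Num.max M `|x0|.
pose E := polyhedron nrm h `&` [set x | `|x| <= B].
suff : E `<=` C by apply; split => //=; rewrite le_max lexx orbT.
apply: complete_core => //.
- apply: bounded_closed_compact.
    exists B; split; first exact: num_real.
    by move=> B' BB' x [_ /le_trans]; apply; exact: ltW.
  apply: closedI; first exact: polyhedron_closed.
  have -> : [set x : vec | `|x| <= B] = (fun x => `|x|) @^-1` [set t | t <= B] by [].
  apply: preimage_closed; last exact: closed_le.
  by move=> x _; exact: norm_continuous.
- move=> x y t [Px xB] [Py yB] t01; split; first exact: polyhedron_convex.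
  rewrite /=; apply: le_trans (ler_normD _ _) _; have /andP[t0 t1] := t01.
  by rewrite !normrZ (ger0_norm t0) ger0_norm ?subr_ge0//; move: xB yB => /=; nra.
- by move=> x Cx; split; [exact: CP|rewrite /= le_max CM].
move=> _ l /gP[i ->] [x [Px _] [y [Py _] E']].
have u0 := normal_gt0 (unP _ (lg i)).
have := Px (i, false); have := Py (i, true); rewrite /nrm /h /= dotpNl lerN2.
have := congr1 (dotp (un (g i))) E'; rewrite !dotpE => E1 h1 h2.
by rewrite -(ler_pM2r u0); lra.
Qed.

Lemma facet_normal_eq (I : finType) (u : I -> vec) (h : I -> R) (p : 'I_d -> vec) w (c : R) :
  C = polyhedron u h -> (forall i, u i <> 0) -> w <> 0 ->
  (forall x, C x -> dotp w x <= c) -> (forall k, C (p k)) ->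
  (forall k, dotp w (p k) = c) -> aff_indep p ->
  exists i, exists2 l : R, 0 < l & w = l *: u i /\ c = l * h i.
Proof.
move=> CE u0 w0 wc Cp pc ap; have Cint : C° !=set0 by case: bC => _ [].
by rewrite CE in wc Cp Cint; exact: (facet_normal d_gt0 Cint u0 w0 wc Cp pc ap).
Qed.

Lemma finite_longest : finite_set longest.
Proof.
have [sL _] := lL; have [r r0 rL] := lattice_gap lL.
have [M M0 MK] := compact_norm_bound (difference_body_compact bC.1).
apply: sub_finite_set (finite_in_ball sL r0 rL (M / D)) => v [Lv v0 Kv].
split => //=; rewrite ler_pdivlMr// mulrC.
by have := MK _ Kv; rewrite normrZ gtr0_norm.
Qed.

(* A facet normal occurs in every slab description of C, so some longest direction has it as its
   only normal. *)
Lemma facet_direction (p : 'I_d -> vec) w (c : R) : lattice_complete L C -> w <> 0 ->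
  (forall x, C x -> dotp w x <= c) -> (forall k, C (p k)) ->
  (forall k, dotp w (p k) = c) -> aff_indep p ->
  exists v, [/\ longest v, normal_at v w &
    forall u, normal_at v u -> exists l : R, u = l *: w].
Proof.
move=> cmp w0 wc Cp pc ap.
have [n [g [_ gP]]] := finite_enum finite_longest.
suff [v [lv vw]] : exists v, longest v /\ forall u, normal_at v u -> exists l : R, u = l *: w.
  have [u uN] := normal_exists lv; have [l uE] := vw u uN.
  have wE : w = l^-1 *: u.
    rewrite uE scalerA mulVf ?scale1r//; apply/eqP => l0.
    by case: uN => u0 _; apply: u0; rewrite uE l0 scale0r.
  have [l0|l0|l0] := ltgtP l 0.
  - exists (- v); split; first exact: longest_directionN.
      have [_ uP] := normalNN uN; split => // x /uP.
      rewrite uE !dotpE => h; have : 0 <= - l by rewrite oppr_ge0 ltW.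
      by move: h; rewrite -subr_ge0; nra.
    move=> u' /normalNN; rewrite opprK => /vw[l' u'E].
    by exists (- l'); rewrite scaleNr -u'E opprK.
  - exists v; split => //; have [_ uP] := uN; split => // x /uP.
    by rewrite uE !dotpZl ler_pM2l.
  - by case: uN => u0 _; case: u0; rewrite uE l0 scale0r.
apply: contrapT => /forallNP H.
have uP v : exists u, longest v -> normal_at v u /\ ~ exists l : R, u = l *: w.
  have [lv|] := pselect (longest v); last by exists 0.
  apply: contrapT => /forallNP Hu; apply: (H v); split => // u uN.
  by apply: contrapT => ul; apply: (Hu u).
have [un {}uP] := choice uP.
have [|h CE] := complete_slabs cmp gP (un := un); first by move=> v /uP[].
have lg i : longest (g i) by apply/gP; exists i.
have [|[i bi] [l l0 [wE _]]] := facet_normal_eq CE _ w0 wc Cp pc ap.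
  move=> [i bi] /=; have [[u0 _] _] := uP _ (lg i).
  by case: bi => // /eqP; rewrite oppr_eq0 => /eqP.
have [_ ul] := uP _ (lg i); apply: ul; move: wE => /=.
case: bi => ->; first by exists l^-1; rewrite scalerA mulVf ?scale1r// gt_eqF.
by exists (- l^-1); rewrite scaleNr !scalerN opprK scalerA mulVf ?scale1r// gt_eqF.
Qed.

Theorem complete_polytope : lattice_complete L C ->
  is_polytope C /\ exists n, (n <= 2 ^ d.+1 - 2)%N /\ num_facets_eq C n.
Proof.
move=> cmp; have [cC _] := bC; have [sL _] := lL.
have [n [g [_ gP]]] := finite_enum finite_longest.
have unP v : exists u, longest v -> normal_at v u.
  have [lv|] := pselect (longest v); last by exists 0.
  by have [u uN] := normal_exists lv; exists u.
have [un {}unP] := choice unP.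
have [h CE] := complete_slabs cmp gP unP.
have lg i : longest (g i) by apply/gP; exists i.
have [M M0 CM] := compact_norm_bound cC.
split; first by rewrite CE; apply: (@bounded_polyhedron_polytope _ _ _ _ _ M); rewrite -CE.
set nrm := (fun i => _) in CE.
have [|m [f [f_inj fP]]] := @finite_enum _ (is_facet C).
  pose F i : set vec := [set x | C x /\ dotp (nrm i) x = h i].
  apply: (@sub_finite_set _ _ (range F)); last by apply: finite_image; exact: finite_finset.
  move=> _ [[w [c [w0 [wc ->]]]] [p [pF ap]]].
  have [|i [l l0 [wE cE]]] :=
      facet_normal_eq CE _ w0 wc (fun k => (pF k).1) (fun k => (pF k).2) ap.
    move=> [i bi]; rewrite /nrm /=; have [u0 _] := unP _ (lg i).
    by case: bi => // /eqP; rewrite oppr_eq0 => /eqP.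
  exists i => //; apply/seteqP; split => x [Cx] /=.
    by move=> xE; split => //; rewrite wE cE dotpZl xE.
  rewrite wE cE dotpZl => /(mulfI _) xE; split => //.
  by apply: xE; rewrite gt_eqF.
exists m; split; last by exists f.
have dP i : exists vwc : vec * vec * R, let: (v, w, c) := vwc in
    [/\ longest v, normal_at v w, forall u, normal_at v u -> exists l : R, u = l *: w,
        f i = [set x | C x /\ dotp w x = c] & f i !=set0 /\ forall x, C x -> dotp w x <= c].
  have [[w [c [w0 [wc fE]]]] [p [pF ap]]] : is_facet C (f i) by apply/fP; exists i.
  have pF' k : C (p k) /\ dotp w (p k) = c by have := pF k; rewrite fE.
  have [v [lv vw vu]] := facet_direction cmp w0 wc (fun k => (pF' k).1) (fun k => (pF' k).2) ap.
  by exists (v, w, c); split => //; split => //; exists (p (Ordinal d_gt0)); exact: pF.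
have [vwc {}dP] := choice dP.
have {}dP i : exists w c, [/\ longest (vwc i).1.1, normal_at (vwc i).1.1 w,
    forall u, normal_at (vwc i).1.1 u -> exists l : R, u = l *: w,
    f i = [set x | C x /\ dotp w x = c] & f i !=set0 /\ forall x, C x -> dotp w x <= c].
  by have := dP i; case: (vwc i) => -[v w] c [? ? ? ? ?]; exists w, c.
pose v i := (vwc i).1.1; have lv i : longest (v i) by case: (dP i) => w [c []].
have [r r0 rL] := lattice_gap lL.
apply: (antipodal_count sL r0 rL (f := v)).
- by move=> i; case: (lv i).
(* Facets sharing a direction have proportional normals; both hyperplanes touch [C], so they
   coincide. *)
- move=> i j vij; apply: f_inj; have [w [c [_ wN wu fi [fi0 wc]]]] := dP i.
  have [w' [c' [_ w'N _ fj [fj0 wc']]]] := dP j.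
  move: w'N; rewrite -/(v j) -vij => w'N; have [l w'E] := wu _ w'N.
  have l0 : 0 < l.
    by have := normal_gt0 w'N; rewrite w'E dotpZl pmulr_lgt0//; exact: normal_gt0 wN.
  have cE : c' = l * c.
    have [x] := fi0; rewrite fi => -[Cx xc]; have [y] := fj0; rewrite fj => -[Cy yc].
    apply/eqP; rewrite eq_le; apply/andP; split.
      by rewrite -yc w'E dotpZl ler_pM2l//; exact: wc.
    by rewrite -xc -dotpZl -w'E; exact: wc'.
  rewrite fi fj; apply/seteqP; split => x [Cx] /=; rewrite w'E cE dotpZl.
    by move=> ->.
  by move=> /(mulfI _) xE; split => //; apply: xE; rewrite gt_eqF.
- move=> i j [z Lz vz]; apply: contrapT => /not_orP[vji vjNi].
  (* For s = v j and s = - v j the midpoint is again longest. A normal there is a normal at [v i],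
     hence a multiple of the normal w of facet i, and agrees on [v i] and s. So w takes one value on
     [v i], [v j] and [- v j], which must be 0. *)
  have mid (s : vec) : longest s -> L (2^-1 *: (v i + s)) -> 2^-1 *: (v i + s) <> 0 ->
      exists2 u, normal_at (v i) u & dotp u (v i) = dotp u s.
    move=> ls Lm m0; have lm : longest (2^-1 *: (v i + s)).
      split => //; have [_ _ Ki] := lv i; have [_ _ Ks] := ls.
      have := difference_body_convex bC.2.1 Ki Ks (t := 2^-1).
      have -> : (1 - 2^-1) *: (D *: v i) + 2^-1 *: (D *: s) = D *: (2^-1 *: (v i + s)).
        by apply/rowP => k; rewrite !mxE; field.
      by apply; lra.
    have [u uN] := normal_exists lm; have [uN' uE] := normal_mid (lv i) ls uN.
    by exists u.
  have viE : v i = 2 *: z + v j by rewrite -vz subrK.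
  have E1 : 2^-1 *: (v i + v j) = z + v j.
    by rewrite viE; apply/rowP => k; rewrite !mxE; field.
  have E2 : 2^-1 *: (v i - v j) = z.
    by rewrite vz scalerA mulVf ?scale1r// pnatr_eq0.
  have [||u1 u1N u1E] := mid (v j) (lv j).
  + by rewrite E1; apply: subgroupD => //; case: (lv j).
  + rewrite E1 => /eqP; rewrite addr_eq0 => /eqP zE; apply: vjNi.
    by rewrite viE zE scalerN scaler_nat mulr2n opprD opprK addrK.
  have [||u2 u2N u2E] := mid (- v j) (longest_directionN lL (lv j)).
  + by rewrite E2.
  + by rewrite E2 => z0; apply: vji; rewrite viE z0 scaler0 add0r.
  have [w [c [_ wN wu _ _]]] := dP i.
  have [l1 E3] := wu _ u1N; have [l2 E4] := wu _ u2N.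
  have w0 := normal_gt0 wN; have := normal_gt0 u1N; have := normal_gt0 u2N.
  move: u1E u2E w0; rewrite E3 E4 !dotpZl dotpNr -/(v i); nra.
(* If v i = 2 z, the direction [z] would have length at least 2 D. *)
- move=> i [z Lz]; rewrite subr0 => vE; have [Lv v0 Kv] := lv i.
  have z0 : z <> 0 by move=> z0; apply: v0; rewrite vE z0 scaler0.
  move: Kv; rewrite vE scalerA => /(diam_ge lL bC Lz z0); have := D0; lra.
Qed.
End Complete.

(** * Extremal polytopes *)

Section IntegerLattice.
Variables (R : realType) (d : nat).
Local Notation vec := 'rV[R]_d.
Implicit Types (x y z : vec).

Definition Zlattice : set vec := [set x | forall i, x 0 i \is a Num.int].

Lemma row_delta_sum x : x = \sum_(i < d) x 0 i *: delta_mx 0 i.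
Proof. by rewrite {1}[x]row_sum_delta. Qed.

Lemma Zlattice_delta i : Zlattice (delta_mx 0 i).
Proof. by move=> j; rewrite mxE eqxx /=; case: (j == i). Qed.

Lemma Zlattice_is_lattice : is_lattice Zlattice.
Proof.
have sZ : is_subgroup Zlattice.
  by split=> [i|x y Zx Zy i]; rewrite !mxE ?rpred0// rpredB.
split => //; split.
  move=> x Zx; exists 1 => // y Zy yx.
  have [i yi] : exists i, (y - x) 0 i != 0.
    apply: contrapT => /forallNP H; apply: yx; apply/subr0_eq/rowP => i.
    by have /negP/negPn/eqP -> := H i; rewrite mxE.
  have Zi := subgroupB sZ Zy Zx i.
  rewrite -[leLHS]sqrtr1 ler_sqrt ?dotp_ge0//.
  apply: (@le_trans _ _ ((y - x) 0 i * (y - x) 0 i)); last first.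
    rewrite /dotp [leRHS](bigD1 i)//= lerDl sumr_ge0// => j _.
    by rewrite -expr2 sqr_ge0.
  have := norm_intr_ge1 Zi yi; rewrite -expr2 -(real_normK (num_real _)).
  by move=> h; rewrite expr_ge1.
move=> x; exists d, (fun i => delta_mx 0 i), (fun i => x 0 i).
by split; [exact: Zlattice_delta|exact: row_delta_sum].
Qed.

Lemma dual_Zlattice : dual_lattice Zlattice = Zlattice.
Proof.
apply/seteqP; split => y Zy.
  by move=> i; rewrite -dotp_delta dotpC; apply: Zy; exact: Zlattice_delta.
by move=> x Zx; apply: rpred_sum => i _; rewrite rpredM.
Qed.
End IntegerLattice.

(* The functionals u i and the lattice vectors v i are biorthogonal in the weak sense uv1, uv_lt.
   The hull of the u i is the polar body (up to scaling) of the polytope {x | u i . x <= 1/2}. *)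
Section SharpExamples.
Variables (R : realType) (d n : nat).
Local Notation vec := 'rV[R]_d.
Local Notation Z := (@Zlattice R d).
Variables (u v : 'I_n -> vec) (op : 'I_n -> 'I_n) (c : R).
Hypothesis d_gt0 : (0 < d)%N.
Hypothesis uv1 : forall i, dotp (u i) (v i) = 1.
Hypothesis uv_lt : forall i j, i != j -> dotp (u i) (v j) < 1.
Hypothesis u_op : forall i, u (op i) = - u i.
Hypothesis Zv : forall i, Z (v i).
Hypothesis norm_ge1 : forall z, Z z -> z <> 0 -> exists i, 1 <= dotp (u i) z.
Hypothesis c_gt0 : 0 < c.
Hypothesis delta_u : forall k, exists i j, delta_mx 0 k = c *: (u i + u j).
Hypothesis sum_v : forall i, dotp (const_mx 1) (v i) != 0.
Implicit Types (x y z : vec).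

Let uv_le i j : dotp (u i) (v j) <= 1.
Proof. by have [->|/uv_lt/ltW//] := eqVneq i j; rewrite uv1. Qed.

Let v_neq0 i : v i <> 0.
Proof. by move=> v0; have := uv1 i; rewrite v0 dotp0r => /eqP; rewrite eq_sym oner_eq0. Qed.

Let u_neq0 i : u i <> 0.
Proof. by move=> u0; have := uv1 i; rewrite u0 dotp0l => /eqP; rewrite eq_sym oner_eq0. Qed.

Let u_inj : injective u.
Proof.
move=> i j uij; apply/eqP/negPn/negP => /uv_lt.
by rewrite uij uv1 ltxx.
Qed.

Local Notation C1 := (conv_hull u).

Let hull_le i x : C1 x -> -1 <= dotp (v i) x <= 1.
Proof.
move=> [a [a0 [a1 ->]]]; rewrite dotp_sumr; apply/andP; split.
  rewrite -a1 -sumrN; apply: ler_sum => j _; rewrite dotpZr -mulrN1 ler_wpM2l//.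
  by have := uv_le (op j) i; rewrite u_op dotpNl dotpC lerNl.
rewrite -a1; apply: ler_sum => j _; rewrite dotpZr -[leRHS]mulr1 ler_wpM2l//.
by rewrite dotpC.
Qed.

(** Equality in the convex combination kills every weight except that of [u i]. *)
Let hull_eq i x : C1 x -> 1 <= dotp (v i) x -> x = u i.
Proof.
move=> [a [a0 [a1 ->]]]; rewrite dotp_sumr => v1.
have h j : 0 <= a j - dotp (v i) (a j *: u j).
  by rewrite dotpZr subr_ge0 -[leRHS]mulr1 ler_wpM2l// dotpC.
have a_0 j : j != i -> a j = 0.
  move=> ji; have : \sum_(j < n) (a j - dotp (v i) (a j *: u j)) == 0.
    by rewrite eq_le sumr_ge0// andbT sumrB a1 subr_le0.
  rewrite psumr_eq0// => /allP/(_ j); rewrite mem_index_enum dotpZr => /(_ isT).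
  rewrite -{1}[a j]mulr1 -mulrBr mulf_eq0 => /orP[/eqP//|].
  by rewrite subr_eq0 dotpC => /eqP E; have := uv_lt ji; rewrite -E ltxx.
have ai : a i = 1.
  by rewrite -a1 (bigD1 i)//= big1 ?addr0// => j /a_0.
by rewrite (bigD1 i)//= ai scale1r big1 ?addr0// => j /a_0 ->; rewrite scale0r.
Qed.

(** By [delta_u], the points at distance s = 1 / (2 c) on each axis are midpoints of two generators,
    or of their opposites. The resulting cross-polytope contains the ball of radius s / d. *)
Lemma hull_body : convex_body C1.
Proof.
split; first exact: conv_hull_compact.
split; first exact: conv_hull_convex.
pose s := (2 * c)^-1; have s0 : 0 < s by rewrite invr_gt0 mulr_gt0.
have half i j : C1 (2^-1 *: (u i + u j)).
  have -> : 2^-1 *: (u i + u j) = (1 - 2^-1) *: u i + 2^-1 *: u j.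
    by rewrite scalerDr; congr (_ *: _ + _); lra.
  by apply: conv_hull_convex; [exact: conv_hull_mem..|lra].
have axis k (t : R) : `|t| <= s -> C1 (t *: delta_mx 0 k).
  move=> ts; have [i [j kE]] := delta_u k.
  have c0 : c != 0 by rewrite gt_eqF.
  have E1 : s *: delta_mx 0 k = 2^-1 *: (u i + u j).
    by rewrite kE scalerA; congr (_ *: _); rewrite /s; field.
  have E2 : - (s *: delta_mx 0 k) = 2^-1 *: (u (op i) + u (op j)).
    by rewrite E1 !u_op -opprD scalerN.
  have P1 := half i j; have P2 := half (op i) (op j); rewrite -E1 in P1; rewrite -E2 in P2.
  have := @conv_hull_convex _ _ _ u _ _ ((t / s + 1) / 2) P2 P1.
  have -> : (1 - (t / s + 1) / 2) *: - (s *: delta_mx 0 k) +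
      ((t / s + 1) / 2) *: (s *: delta_mx 0 k) = t *: delta_mx 0 k :> vec.
    by apply/rowP => l; rewrite !mxE; field; rewrite gt_eqF.
  apply; move: ts; rewrite ler_norml => /andP[t1 t2].
  have : -1 <= t / s by rewrite ler_pdivlMr// mulN1r.
  have : t / s <= 1 by rewrite ler_pdivrMr// mul1r.
  lra.
have dR : 0 < d%:R :> R by rewrite ltr0n.
exists 0; apply: (@ball_interior _ _ _ _ (s / d%:R)); first by rewrite divr_gt0.
move=> x xs; rewrite add0r (row_delta_sum x).
have -> : \sum_(k < d) x 0 k *: delta_mx 0 k =
    \sum_(k < d) d%:R^-1 *: ((d%:R * x 0 k) *: delta_mx 0 k) :> vec.
  by apply: eq_bigr => k _; rewrite scalerA mulKf// gt_eqF.
apply: convex_sum; first exact: conv_hull_convex.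
- by move=> k; rewrite invr_ge0 ltW.
- by rewrite sumr_const card_ord -[LHS]mulr_natl divff// gt_eqF.
move=> k; apply: axis; rewrite normrM (gtr0_norm dR) mulrC -ler_pdivlMr//.
by apply: le_trans xs; exact: coord_le_norm.
Qed.

Lemma hull_width : 2 <= lattice_width Z C1.
Proof.
have [i0 _] := delta_u (Ordinal d_gt0).
apply: lb_le_inf.
  by exists (width_dir C1 (v i0)), (v i0); rewrite dual_Zlattice.
move=> _ [z [Lz [z0 ->]]]; rewrite dual_Zlattice in Lz.
have [i iz] := norm_ge1 Lz z0.
apply: le_trans (width_dir_ge z hull_body.1 (conv_hull_mem u i) (conv_hull_mem u (op i))).
by rewrite u_op opprK dotpC dotpDl; lra.
Qed.

(** On the hull [v i] ranges over [-1, 1], so a subset of width at least 2 must reach the value 1,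
    which happens only at [u i]; it therefore contains every generator. *)
Lemma hull_reduced : lattice_reduced Z C1.
Proof.
move=> [C' [bC' [[C'C CC'] wE]]]; apply: CC'; apply: conv_hull_sub; first exact: bC'.2.1.
move=> i; have := @lattice_width_le _ _ Z C' (v i) bC'.
rewrite dual_Zlattice wE => /(_ (Zv i) (@v_neq0 i)).
have [a [b [C'a C'b _ _ ->]]] := width_dirP (v i) bC'.1 (body_neq0 bC').
move=> /(le_trans hull_width); rewrite dotpBr => h.
have /andP[hb _] := hull_le i (C'C _ C'b).
by rewrite -(@hull_eq i a)//; [exact: C'C|lra].
Qed.

Lemma hull_vertices : num_vertices_eq C1 n.
Proof.
exists u; split=> [|x]; [exact: u_inj|split; first exact: vertex_conv_hull].
move=> [i ->]; split; first exact: conv_hull_mem.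
move=> y z t Cy Cz /andP[t0 t1] E.
have /andP[_ y1] := hull_le i Cy; have /andP[_ z1] := hull_le i Cz.
have := congr1 (dotp (v i)) E; rewrite dotpC uv1 dotpDr !dotpZr => E1.
set Y := dotp (v i) y in y1 E1; set X := dotp (v i) z in z1 E1.
have yv : 1 <= Y.
  have : 0 <= (1 - t) * (Y - 1) by have := mulr_ge0 (ltW t0) (_ : 0 <= 1 - X); lra.
  by rewrite pmulr_rge0 ?subr_gt0// subr_ge0.
have zv : 1 <= X.
  have : 0 <= t * (X - 1) by have := mulr_ge0 (_ : 0 <= 1 - t) (_ : 0 <= 1 - Y); lra.
  by rewrite pmulr_rge0// subr_ge0.
by rewrite (hull_eq Cy yv) (hull_eq Cz zv).
Qed.

Local Notation C2 := (polyhedron u (fun=> 2^-1)).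

Let poly_bounded x : C2 x -> `|x| <= c.
Proof.
move=> Cx; apply: norm_le_coord (ltW c_gt0) _ => k.
have [i [j kE]] := delta_u k.
have xk : x 0 k = c * (dotp (u i) x + dotp (u j) x).
  by rewrite -dotp_delta kE dotpZr dotpDr !(dotpC x).
rewrite xk normrM gtr0_norm// -[leRHS]mulr1 ler_pM2l// ler_norml.
have := Cx (op i); have := Cx (op j); rewrite !u_op !dotpNl.
by have := Cx i; have := Cx j => *; apply/andP; split; lra.
Qed.

Lemma poly_body : convex_body C2.
Proof.
split.
  apply: bounded_closed_compact (@polyhedron_closed _ _ _ _ _).
  exists c; split; first exact: num_real.
  by move=> M cM x /poly_bounded/le_trans; apply; exact: ltW.
split; first exact: polyhedron_convex.
pose S := \sum_(i < n) \sum_(k < d) `|u i 0 k|.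
have S0 : 0 <= S by apply: sumr_ge0 => i _; exact: sumr_ge0.
have D0 : 0 < 2 * (1 + S) by lra.
exists 0; apply: (@ball_interior _ _ _ _ (2 * (1 + S))^-1); first by rewrite invr_gt0.
move=> x xS i; rewrite add0r; apply: le_trans (ler_norm _) _.
apply: le_trans (dotp_le_norm _ _) _.
have Si : \sum_(k < d) `|u i 0 k| <= S.
  by rewrite /S [leRHS](bigD1 i)//= lerDl; apply: sumr_ge0 => j _; exact: sumr_ge0.
have Si0 : 0 <= \sum_(k < d) `|u i 0 k| by exact: sumr_ge0.
apply: (@le_trans _ _ (S * (2 * (1 + S))^-1)); first exact: ler_pM.
by rewrite ler_pdivrMr//; lra.
Qed.

Lemma poly_polytope : is_polytope C2.
Proof. exact: bounded_polyhedron_polytope poly_bounded. Qed.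

Let poly_half i : C2 (2^-1 *: v i).
Proof. by move=> j; rewrite dotpZr; have := uv_le j i; lra. Qed.

Let poly_diam : lattice_diam Z C2 <= 1.
Proof.
apply: diam_le => // z l Zz z0 [a Ca [b Cb E]]; have [l0|l0] := leP l 0; first by lra.
have [i iz] := norm_ge1 Zz z0.
have := Cb i; have := Ca (op i); rewrite u_op dotpNl => h1 h2.
by have := congr1 (dotp (u i)) E; rewrite dotpZr dotpBr; nra.
Qed.

(** Suppose x violates constraint i. Move from v i / 2, where only that constraint is tight,
    slightly towards x, then back by [l *: v i] with l > 1: the endpoint lies in the polytope, so
    the larger body has diameter above 1. *)
Lemma poly_complete : lattice_complete Z C2.
Proof.
move=> [C' [bC' [[CC' C'C] dE]]]; apply: C'C => x C'x; apply: contrapT => /existsNP[i /negP].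
rewrite -ltNge => xi; pose h := dotp (u i) x - 2^-1; have h0 : 0 < h by rewrite subr_gt0.
(* [a0 j + e * b0 j] is the excess of constraint j at [b - l *: v i]. The constraint opposite to i
   is exactly tight there for every e, so it gets dummy values. *)
pose a0 j := if op j == i then -1 else - (dotp (u j) (v i) / 2) - 2^-1.
pose b0 j := if op j == i then 0 else
  dotp (u j) x - dotp (u j) (v i) / 2 - h * dotp (u j) (v i).
have [j|e /andP[e0 e1] eP] := @small_perturbation _ _ a0 b0.
  rewrite /a0; case: ifP => [_|/negbT ji]; first by lra.
  by have := uv_lt ji; rewrite u_op dotpNl; lra.
pose b := (1 - e) *: (2^-1 *: v i) + e *: x.
have C'b : C' b.
  by apply: bC'.2.1 => //; [exact/CC'/poly_half|rewrite (ltW e0) (ltW e1)].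
pose l := 1 + e * h; have l1 : 1 < l by rewrite ltrDl mulr_gt0.
have Ca : C2 (b - l *: v i).
  move=> j; rewrite dotpBr /b !(dotpDr, dotpZr) /l.
  have := eP j; rewrite /a0 /b0; have [ji|ji] := eqVneq (op j) i; last by lra.
  have -> : u j = - u i by rewrite -ji u_op opprK.
  by rewrite !dotpNl uv1 /h; lra.
have : l <= 1.
  apply: le_trans poly_diam; rewrite -dE.
  apply: (diam_ge (@Zlattice_is_lattice R d) bC' (Zv i) (@v_neq0 i)).
  by exists (b - l *: v i); [exact: CC'|exists b => //; rewrite opprB addrC subrK].
by rewrite leNgt l1.
Qed.

Let face i : set vec := [set x | C2 x /\ dotp (u i) x = 2^-1].

(** The points are v i / 2 + e w_k, with w_k the projection of the k-th unit vector along [v i] onto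
    the kernel of [u i]. The linear relations among the w_k are the multiples of the coordinates of
    [v i]; their nonzero sum, [sum_v], excludes an affine relation. *)
Let face_facet i : is_facet C2 (face i).
Proof.
split; first by exists (u i), 2^-1.
pose w k : vec := delta_mx 0 k - u i 0 k *: v i.
have uw k : dotp (u i) (w k) = 0.
  by rewrite dotpBr dotpZr dotp_delta uv1 mulr1 subrr.
pose a0 (jk : 'I_n * 'I_d) := if jk.1 == i then -1 else dotp (u jk.1) (v i) / 2 - 2^-1.
pose b0 (jk : 'I_n * 'I_d) := if jk.1 == i then 0 else dotp (u jk.1) (w jk.2).
have [[j k]|e /andP[e0 e1] eP] := @small_perturbation _ _ a0 b0.
  rewrite /a0 /=; case: ifP => [_|/negbT ji]; first by lra.
  by have := uv_lt ji; lra.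
exists (fun k => 2^-1 *: v i + e *: w k); split.
  move=> k; split; last by rewrite dotpDr !dotpZr uw uv1; lra.
  move=> j; rewrite dotpDr !dotpZr; have [->|ji] := eqVneq j i.
    by rewrite uw uv1; lra.
  by have := eP (j, k); rewrite /a0 /b0 /= (negbTE ji); lra.
move=> a a0' aE k; pose r : vec := \row_k a k.
have rE : r = dotp (u i) r *: v i.
  have : \sum_(k < d) a k *: (e *: w k) = 0.
    rewrite -[RHS]aE; under [RHS]eq_bigr do rewrite scalerDr.
    by rewrite big_split /= -scaler_suml a0' scale0r add0r.
  have -> : \sum_(k < d) a k *: (e *: w k) = e *: (r - dotp (u i) r *: v i).
    rewrite {1}(row_delta_sum r) scalerBr scaler_sumr /dotp scaler_suml scaler_sumr -sumrB.
    apply: eq_bigr => l _; rewrite /w /r !mxE; apply/rowP => m; rewrite !mxE; ring.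
  by move/eqP; rewrite scaler_eq0 gt_eqF//= subr_eq0 => /eqP.
have s0 : dotp (const_mx 1) r = 0.
  by rewrite -[RHS]a0'; apply: eq_bigr => l _; rewrite !mxE mul1r.
have /eqP : dotp (u i) r * dotp (const_mx 1) (v i) = 0 by rewrite -dotpZr -rE.
rewrite mulf_eq0 (negbTE (sum_v i)) orbF => /eqP ur.
by have := congr1 (fun x : vec => x 0 k) rE; rewrite ur scale0r !mxE.
Qed.

Lemma poly_facets : num_facets_eq C2 n.
Proof.
exists face; split.
  move=> i j /seteqP[/(_ (2^-1 *: v i)) ij _].
  have [|_] := ij; first by split; [exact: poly_half|rewrite dotpZr uv1 mulr1].
  rewrite dotpZr => E; apply/eqP/negPn/negP; rewrite eq_sym => /uv_lt; lra.
move=> F; split; last by move=> [i ->]; exact: face_facet.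
move=> [[w [b [w0 [wb ->]]]] [p [pF ap]]].
have [i [l l0 [wE bE]]] := facet_normal d_gt0 poly_body.2.2 u_neq0 w0 wb
  (fun k => (pF k).1) (fun k => (pF k).2) ap.
exists i; apply/seteqP; split => x [Cx] /=; rewrite wE bE dotpZl.
  by move=> /(mulfI _) xE; split => //; apply: xE; rewrite gt_eqF.
by move=> ->.
Qed.
End SharpExamples.

(* The polytope {x | |u_T . x| <= 1/2} is, up to a linear map, the Voronoi cell of the lattice A_d^*
   dual to the root lattice A_d.  Vectors of R^d are read as functions on
   {0, ..., d} vanishing at 0; u_T averages over T and subtracts the average over the complement,
   and v_T is the indicator of T, shifted by a constant so as to vanish at 0. *)
Section SubsetVectors.
Variables (R : realType) (d : nat).
Local Notation vec := 'rV[R]_d.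
Implicit Types (x z : vec) (T S : {set 'I_d.+1}) (k : 'I_d.+1).

Definition proper_nonempty := [pred T : {set 'I_d.+1} | (T != finset.set0) && (T != finset.setT)].

Lemma card_proper_nonempty : #|proper_nonempty| = (2 ^ d.+1 - 2)%N.
Proof.
have -> : #|proper_nonempty| = #|~: [set finset.set0; finset.setT : {set 'I_d.+1}]|.
  by apply: eq_card => T; rewrite !inE negb_or.
have := cardsC [set finset.set0; finset.setT : {set 'I_d.+1}]%SET.
rewrite cards2.
have -> : finset.set0 != finset.setT :> {set 'I_d.+1}.
  by apply/eqP => /setP/(_ ord0); rewrite !inE.
have -> : #|{set 'I_d.+1}| = (2 ^ d.+1)%N.
  by rewrite -cardsT -powersetT card_powerset finset.cardsT card_ord.
by move=> <-; rewrite addnC addnK.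
Qed.

Definition coef T k : R := if k \in T then #|T|%:R^-1 else - #|~: T|%:R^-1.
Definition ext x k : R := oapp (fun i => x 0 i) 0 (unlift ord0 k).
Definition uT T : vec := \row_i coef T (lift ord0 i).
Definition vT T : vec := \row_i ((lift ord0 i \in T)%:R - (ord0 \in T)%:R).

Lemma dotp_uT T x : dotp (uT T) x = \sum_k coef T k * ext x k.
Proof.
rewrite big_ord_recl /ext unlift_none mulr0 add0r.
by apply: eq_bigr => i _; rewrite liftK mxE.
Qed.

Lemma coef_gt0 T k : k \in T -> 0 < coef T k.
Proof.
by move=> kT; rewrite /coef kT invr_gt0 ltr0n card_gt0; apply/set0Pn; exists k.
Qed.

Lemma coef_lt0 T k : k \notin T -> coef T k < 0.
Proof.
move=> kT; rewrite /coef (negbTE kT) oppr_lt0 invr_gt0 ltr0n card_gt0.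
by apply/set0Pn; exists k; rewrite finset.in_setC.
Qed.

Lemma card_neq0 T : T != finset.set0 -> (#|T|%:R : R) != 0.
Proof. by rewrite pnatr_eq0 cards_eq0. Qed.

Lemma setC_neq0 T : T != finset.setT -> ~: T != finset.set0.
Proof. by apply: contra => /eqP E; rewrite -[T]finset.setCK E finset.setC0. Qed.

Lemma sum_coef_in T : T != finset.set0 -> \sum_(k in T) coef T k = 1.
Proof.
move=> T0; rewrite (eq_bigr (fun=> #|T|%:R^-1)) => [|k kT]; last by rewrite /coef kT.
by rewrite sumr_const -[LHS]mulr_natl divff// card_neq0.
Qed.

Lemma coefC T k : coef (~: T) k = - coef T k.
Proof. by rewrite /coef finset.in_setC finset.setCK; case: (k \in T); rewrite ?opprK. Qed.

Lemma sum_coef T : T \in proper_nonempty -> \sum_k coef T k = 0.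
Proof.
move=> /andP[T0 T1]; rewrite (bigID (mem T)) /= sum_coef_in//.
have := sum_coef_in (setC_neq0 T1); rewrite (eq_bigr _ (fun k _ => coefC T k)).
rewrite (eq_bigl (fun k => k \notin T)) => [|k]; last by rewrite finset.in_setC.
by rewrite sumrN => <-; rewrite addrC subrr.
Qed.

(** The coefficients sum to 0, so the normalization at index 0 is immaterial. *)
Lemma dotp_uT_shift T x (a : R) : T \in proper_nonempty ->
  dotp (uT T) x = \sum_k coef T k * (ext x k - a).
Proof.
move=> /sum_coef T0; under eq_bigr do rewrite mulrBr.
by rewrite sumrB -mulr_suml T0 mul0r subr0 dotp_uT.
Qed.

Lemma dotp_uvT T S : T \in proper_nonempty ->
  dotp (uT T) (vT S) = \sum_k coef T k * (k \in S)%:R.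
Proof.
move=> PT; rewrite (dotp_uT_shift _ (- (ord0 \in S)%:R) PT); apply: eq_bigr => k _.
congr (_ * _); rewrite opprK /ext; case: unliftP => [i ->|->] /=; last by rewrite add0r.
by rewrite mxE subrK.
Qed.

Lemma uvT1 T : T \in proper_nonempty -> dotp (uT T) (vT T) = 1.
Proof.
move=> PT; rewrite dotp_uvT//; have /andP[T0 _] := PT.
rewrite -[RHS](sum_coef_in T0) [RHS]big_mkcond; apply: eq_bigr => k _.
by case: (k \in T); rewrite ?mulr1 ?mulr0.
Qed.

(** The coefficients are positive on [T] and negative off it, so each index where [S] differs from
    [T] costs a positive amount. *)
Lemma uvT_lt T S : T \in proper_nonempty -> T != S -> dotp (uT T) (vT S) < 1.
Proof.
move=> PT TS; rewrite -(uvT1 PT) !dotp_uvT// -subr_gt0 -sumrB.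
have [k kTS] : exists k, (k \in T) != (k \in S).
  apply/existsP; apply: contraNT TS; rewrite negb_exists => /forallP H.
  by apply/eqP/setP => k; apply/eqP; rewrite -[_ == _]negbK.
have ge0 j : 0 <= coef T j * (j \in T)%:R - coef T j * (j \in S)%:R.
  have [jT|jT] := boolP (j \in T); have := coef_gt0; have := coef_lt0.
    by move=> _ /(_ _ _ jT); case: (j \in S); rewrite ?mulr1 ?mulr0; lra.
  by move=> /(_ _ _ jT) h _; case: (j \in S); rewrite ?mulr1 ?mulr0; lra.
rewrite (bigD1 k)//=; apply: ltr_pwDl; last by apply: sumr_ge0.
have [kT|kT] := boolP (k \in T); move: kTS.
  rewrite kT; case: (k \in S) => // _.
  by rewrite mulr1 mulr0 subr0 coef_gt0.
rewrite (negbTE kT); case: (k \in S) => // _.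
by rewrite mulr1 mulr0 sub0r oppr_gt0 coef_lt0.
Qed.

Lemma uTC T : uT (~: T) = - uT T.
Proof. by apply/rowP => i; rewrite !mxE coefC. Qed.

Lemma vT_int T : Zlattice (vT T).
Proof. by move=> i; rewrite mxE rpredB// rpred_nat. Qed.

Lemma ext_int z k : Zlattice z -> ext z k \is a Num.int.
Proof. by move=> Zz; rewrite /ext; case: unliftP => [i _|_] /=; rewrite ?rpred0. Qed.

(** Take for [T] the indices where z, extended by 0, is maximal: by integrality it is smaller by at
    least 1 elsewhere, and so are the averages. [T] is proper because a constant extension is 0. *)
Lemma uT_ge1 z : Zlattice z -> z <> 0 -> exists2 T, T \in proper_nonempty & 1 <= dotp (uT T) z.
Proof.
move=> Zz z0.
case: (@Order.TotalTheory.arg_maxP _ _ _ (ord0 : 'I_d.+1) xpredT (ext z)) => // m _ mmax.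
pose T := [set k | ext z k == ext z m]%SET.
have T0 : T != finset.set0 by apply/set0Pn; exists m; rewrite inE.
have T1 : T != finset.setT.
  apply/eqP => /setP TE; apply: z0; apply/rowP => i.
  have := TE (lift ord0 i); have := TE ord0; rewrite !inE => /eqP <-.
  by rewrite /ext liftK unlift_none /= mxE => /eqP.
have PT : T \in proper_nonempty by rewrite inE T0.
exists T => //; rewrite (dotp_uT_shift _ (ext z m) PT) -(sum_coef_in (setC_neq0 T1)).
rewrite big_mkcond; apply: ler_sum => k _; rewrite finset.in_setC.
have [kT|kT] := boolP (k \in T); rewrite /=.
  by move: kT; rewrite inE => /eqP ->; rewrite subrr mulr0.
rewrite coefC -mulrN1; apply: ler_wnM2l; first exact/ltW/coef_lt0.
have : ext z k < ext z m.
  by rewrite lt_neqAle; move: kT; rewrite inE => -> /=; exact: mmax.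
have /intrP[a ->] := ext_int k Zz; have /intrP[b ->] := ext_int m Zz.
by rewrite ltr_int -intrB -[-1]/((-1)%:~R) ler_int; lia.
Qed.

(** The first vector has entry 1 at i and -1/d elsewhere, the second has all entries 1/d; their sum
    is 1 + 1/d times the unit vector. *)
Lemma delta_uT (i : 'I_d) : delta_mx 0 i =
  (d%:R / d.+1%:R) *: (uT [set lift ord0 i]%SET + uT (~: [set ord0]%SET)).
Proof.
have d0 : (d%:R : R) != 0 by rewrite pnatr_eq0; case: d i => [[]|].
have d1 : (d.+1%:R : R) != 0 by rewrite pnatr_eq0.
apply/rowP => j; rewrite !mxE /= /coef !inE finset.setCK.
rewrite (inj_eq lift_inj) cards1 !cardsC1 !card_ord /=.
rewrite eq_sym; case: (i == j) => /=; last by rewrite addNr mulr0.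
by rewrite mulrAC mulrDr invr1 mulr1 divff// natr1 divff.
Qed.

(** The entries of [vT T] all lie in {0, 1} or all in {-1, 0}, so a zero sum makes them vanish and
    [T] trivial. *)
Lemma sum_vT T : T \in proper_nonempty -> dotp (const_mx 1) (vT T) != 0.
Proof.
move=> /andP[T0 T1].
have -> : dotp (const_mx 1) (vT T) =
    \sum_(i < d) ((lift ord0 i \in T)%:R - (ord0 \in T)%:R).
  by apply: eq_bigr => i _; rewrite !mxE mul1r.
have all_eq : ~ forall i : 'I_d, (lift ord0 i \in T) = (ord0 \in T).
  move=> H; have {}H k : (k \in T) = (ord0 \in T) by case: (unliftP ord0 k) => [j|] ->.
  case E : (ord0 \in T).
    by move/eqP: T1; apply; apply/setP => k; rewrite H E !inE.
  by move/eqP: T0; apply; apply/setP => k; rewrite H E !inE.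
apply/eqP => s0; apply: all_eq => i; apply/eqP; case E : (ord0 \in T) s0 => /eqP.
  rewrite -oppr_eq0 -sumrN psumr_eq0 => [/allP/(_ i)|j _].
    by rewrite mem_index_enum => /(_ isT); case: (_ \in T) => //; rewrite sub0r opprK oner_eq0.
  by case: (_ \in T); rewrite /= ?subrr ?oppr0// sub0r opprK.
rewrite psumr_eq0 => [/allP/(_ i)|j _].
  by rewrite mem_index_enum => /(_ isT); case: (_ \in T) => //; rewrite subr0 oner_eq0.
by case: (_ \in T); rewrite /= subr0.
Qed.

Lemma set1_proper k : (0 < d)%N -> [set k]%SET \in proper_nonempty.
Proof.
move=> d0; rewrite inE -!cards_eq0 cards1 /=; apply/eqP => /(congr1 (fun T => #|T : {set _}|)).
by rewrite cards1 finset.cardsT card_ord => -[d1]; rewrite -d1 in d0.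
Qed.

Lemma enum_proper T : T \in proper_nonempty ->
  exists i : 'I_#|proper_nonempty|, enum_val i = T.
Proof. by move=> PT; exists (enum_rank_in PT T); rewrite enum_rankK_in. Qed.

Lemma setC_proper T : T \in proper_nonempty -> ~: T \in proper_nonempty.
Proof.
move=> /andP[T0 T1]; rewrite inE setC_neq0//=.
by apply: contra T0 => /eqP E; rewrite -[T]finset.setCK E finset.setCT.
Qed.
End SubsetVectors.

Theorem theorem1p2 (R : realType) (d : nat) (hd : (1 <= d)%N) :
  (* (1) *)
  (forall (L C : set 'rV[R]_d), is_lattice L -> convex_body C ->
     lattice_reduced L C ->
     is_polytope C /\ exists n, (n <= 2 ^ d.+1 - 2)%N /\ num_vertices_eq C n) /\
  (* (2) *)
  (forall (L C : set 'rV[R]_d), is_lattice L -> convex_body C ->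
     lattice_complete L C ->
     is_polytope C /\ exists n, (n <= 2 ^ d.+1 - 2)%N /\ num_facets_eq C n) /\
  (* sharpness for (1) *)
  (exists (L C : set 'rV[R]_d), is_lattice L /\ convex_body C /\
     is_polytope C /\ lattice_reduced L C /\ num_vertices_eq C (2 ^ d.+1 - 2)) /\
  (* sharpness for (2) *)
  (exists (L C : set 'rV[R]_d), is_lattice L /\ convex_body C /\
     is_polytope C /\ lattice_complete L C /\ num_facets_eq C (2 ^ d.+1 - 2)).
Proof.
split; first by move=> L C lL bC; exact: reduced_polytope.
split; first by move=> L C lL bC; exact: complete_polytope.
rewrite -card_proper_nonempty.
pose u (i : 'I_#|proper_nonempty d|) := @uT R d (enum_val i).
pose v (i : 'I_#|proper_nonempty d|) := @vT R d (enum_val i).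
have opP (i : 'I_#|proper_nonempty d|) : exists j : 'I_#|proper_nonempty d|, enum_val j = ~: enum_val i.
  exact/enum_proper/setC_proper/enum_valP.
have [op {}opP] := choice opP.
have uv1 i : dotp (u i) (v i) = 1 by apply: uvT1; exact: enum_valP.
have uv_lt i j : i != j -> dotp (u i) (v j) < 1.
  by move=> ij; apply: uvT_lt; [exact: enum_valP|rewrite (inj_eq enum_val_inj)].
have u_op i : u (op i) = - u i by rewrite /u opP uTC.
have Zv i : Zlattice (v i) by exact: vT_int.
have norm_ge1 z : Zlattice z -> z <> 0 -> exists i, 1 <= dotp (u i) z.
  by move=> Zz z0; have [T /enum_proper[i <-]] := uT_ge1 Zz z0; exists i.
pose c : R := d%:R / d.+1%:R.
have c_gt0 : 0 < c by rewrite divr_gt0 ?ltr0n.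
have ord0_proper : [set ord0 : 'I_d.+1]%SET \in proper_nonempty d.
  exact: set1_proper.
have delta_u k : exists i j, delta_mx 0 k = c *: (u i + u j).
  have [i iE] : exists i : 'I_#|proper_nonempty d|, enum_val i = [set lift ord0 k]%SET.
    exact/enum_proper/set1_proper.
  have [j jE] := enum_proper (setC_proper ord0_proper).
  by exists i, j; rewrite /u iE jE; exact: delta_uT.
have sum_v i : dotp (const_mx 1) (v i) != 0 by apply: sum_vT; exact: enum_valP.
split; exists (@Zlattice R d).
  exists (conv_hull u); split; first exact: Zlattice_is_lattice.
  split; first exact: (hull_body hd u_op c_gt0 delta_u).
  split; first by exists #|proper_nonempty d|, u.
  split; last exact: (hull_vertices uv1 uv_lt u_op).
  exact: (hull_reduced hd uv1 uv_lt u_op Zv norm_ge1 c_gt0 delta_u).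
exists (polyhedron u (fun=> 2^-1)); split; first exact: Zlattice_is_lattice.
split; first exact: (poly_body u_op c_gt0 delta_u).
split; first exact: (poly_polytope u_op c_gt0 delta_u).
split; last exact: (poly_facets hd uv1 uv_lt u_op c_gt0 delta_u sum_v).
exact: (poly_complete uv1 uv_lt u_op Zv norm_ge1).
Qed.
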